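(* Let $p_{1}, p_{2}, p_{3}, q_{1}, q_{2}$ be distinct prime numbers with $p_{1} \equiv p_{2} \equiv q_{1} \equiv q_{2} \equiv 3 \pmod 4$ and $p_{3} \equiv 1 \pmod 4$, such that $q_{1}q_{2} \equiv p_{1}p_{2}p_{3} \equiv 1 \pmod 8$, and let $K = \mathbb{Q}(\sqrt{q_{1}q_{2}}, \sqrt{p_{1}p_{2}p_{3}})$. Then $K$ is a Pólya field in each of the following cases (where $\big(\frac{\cdot}{\cdot}\big)$ is the Legendre symbol): \begin{enumerate} \item $\big(\frac{p_{1}}{p_{2}}\big) = 1$, $\big(\frac{p_{1}}{p_{3}}\big) = 1$, $\big(\frac{p_{2}}{p_{3}}\big) = -1$, $\big(\frac{p_{3}}{q_{1}}\big) = \big(\frac{p_{3}}{q_{2}}\big) = \big(\frac{p_{1}}{q_{1}}\big) = \big(\frac{p_{1}}{q_{2}}\big) = -1$ and $\big(\frac{q_{1}q_{2}}{p_{2}}\big) = -1$. \item $\big(\frac{p_{1}}{p_{2}}\big) = 1$, $\big(\frac{p_{1}}{p_{3}}\big) = -1$, $\big(\frac{p_{2}}{p_{3}}\big) = 1$, $\big(\frac{p_{3}}{q_{1}}\big) = \big(\frac{p_{3}}{q_{2}}\big) = - \big(\frac{p_{1}}{q_{1}}\big) = - \big(\frac{p_{1}}{q_{2}}\big) = -1$ and $\big(\frac{q_{1}q_{2}}{p_{2}}\big) = -1$. \item $\big(\frac{p_{1}}{p_{3}}\big) = -1$, $\big(\frac{p_{2}}{p_{3}}\big) = -1$, $\big(\frac{p_{3}}{q_{1}}\big)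 = - \big(\frac{p_{3}}{q_{2}}\big) = 1$ and $\big(\frac{p_{1}p_{2}}{q_{1}}\big) = \big(\frac{p_{1}p_{2}}{q_{2}}\big) = - \big(\frac{q_{1}q_{2}}{p_{1}}\big) = -1$. \item $\big(\frac{p_{1}}{p_{2}}\big) = -1$, $\big(\frac{p_{1}}{p_{3}}\big) = 1$, $\big(\frac{p_{2}}{p_{3}}\big) = -1$, $\big(\frac{p_{3}}{q_{1}}\big) = \big(\frac{p_{3}}{q_{2}}\big) = -1$ and $\big(\frac{p_{1}p_{2}}{q_{1}}\big) = \big(\frac{p_{1}p_{2}}{q_{2}}\big) = - \big(\frac{q_{1}q_{2}}{p_{1}}\big) = 1$. \item $\big(\frac{p_{1}}{p_{2}}\big) = -1$, $\big(\frac{p_{1}}{p_{3}}\big) = -1$, $\big(\frac{p_{2}}{p_{3}}\big) = 1$, $\big(\frac{p_{3}}{q_{1}}\big) = \big(\frac{p_{3}}{q_{2}}\big) = \big(\frac{p_{1}}{q_{1}}\big) = \big(\frac{p_{1}}{q_{2}}\big) = -1$ and $\big(\frac{q_{1}q_{2}}{p_{2}}\big) = -1$. \end{enumerate} Moreover, if $\big(\frac{p_{1}}{p_{3}}\big) = \big(\frac{p_{2}}{p_{3}}\big) = 1$, then either $K$ is a Pólya field or $Po(K) \simeq \mathbb{Z}/2\mathbb{Z}$.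
   Context: For a number field $K$ with ring of integers $\mathcal{O}_{K}$, a rational prime $p$ and an integer $f \geq 1$, the Ostrowski ideal $\Pi_{p^{f}}(K)$ is the product of all maximal ideals $\mathfrak{m}$ of $\mathcal{O}_{K}$ with norm $N_{K/\mathbb{Q}}(\mathfrak{m}) = p^{f}$ (an empty product being $\mathcal{O}_K$). The Pólya group $Po(K)$ is the subgroup of the ideal class group of $K$ generated by the ideal classes of all Ostrowski ideals $\Pi_{p^{f}}(K)$. The field $K$ is called a Pólya field if all the Ostrowski ideals are principal, equivalently if $Po(K)$ is trivial. *)

(* Defs.v *)
From HB Require Import structures.
From mathcomp Require Import all_boot all_order all_algebra all_field.
From mathcomp Require Import finmap.
From mathcomp Require Import boolp classical_sets functions cardinality fsbigop.

Set Implicit Arguments.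
Unset Strict Implicit.
Unset Printing Implicit Defensive.

Import Order.TTheory GRing.Theory Num.Theory.

Local Open Scope classical_set_scope.
Local Open Scope ring_scope.
Local Open Scope quotient_scope.

Section Ideals.
Variable R : idomainType.

(* Unlike the library's [idealr], an ideal may be the whole ring. *)
Definition ideal_axiom (I : {pred R}) :=
  zmod_closed I /\ (forall a x : R, x \in I -> a * x \in I).

Record ideal := Ideal { ideal_pred : R -> bool; _ : ideal_axiom ideal_pred }.

HB.instance Definition _ := gen_eqMixin ideal.
HB.instance Definition _ := gen_choiceMixin ideal.

Definition ideal_mem (I : ideal) : {pred R} := ideal_pred I.
Coercion ideal_mem : ideal >-> pred_sort.

Lemma idealP (I : ideal) : ideal_axiom I.
Proof. by case: I. Qed.

HB.instance Definition _ (I : ideal) :=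
  GRing.isZmodClosed.Build R (ideal_mem I) (idealP I).1.

Lemma idealMl (I : ideal) a x : x \in I -> a * x \in I.
Proof. exact: (idealP I).2. Qed.

Lemma idealMr (I : ideal) a x : x \in I -> x * a \in I.
Proof. by rewrite mulrC; exact: idealMl. Qed.

Lemma eq_ideal (I J : ideal) : (forall x, (x \in I) = (x \in J)) -> I = J.
Proof.
case: I J => [I HI] [J HJ] /= eqIJ.
have E : I = J by apply/funext => x; exact: eqIJ.
by case: _ / E HJ => HJ; congr Ideal; exact: Prop_irrelevance.
Qed.

Definition ideal_principal_pred (a : R) : {pred R} :=
  fun x => `[< exists b : R, x = b * a >].

Lemma ideal_principal_axiom a : ideal_axiom (ideal_principal_pred a).
Proof.
split=> [|c x /asboolP[b ->]]; last by apply/asboolP; exists (c * b); rewrite mulrA.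
split=> [|x y /asboolP[b ->] /asboolP[c ->]]; apply/asboolP.
  by exists 0; rewrite mul0r.
by exists (b - c); rewrite mulrBl.
Qed.

Definition ideal_principal a := Ideal (ideal_principal_axiom a).

Definition is_principal (I : ideal) := exists a : R, I = ideal_principal a.

Definition ideal0 : ideal := ideal_principal 0.
Definition ideal1 : ideal := ideal_principal 1.

Lemma mem_ideal_principal a x :
  reflect (exists b : R, x = b * a) (x \in ideal_principal a).
Proof. exact: asboolP. Qed.

Lemma mem_ideal1 x : x \in ideal1.
Proof. by apply/mem_ideal_principal; exists x; rewrite mulr1. Qed.

Definition ideal_mul_pred (I J : ideal) : {pred R} :=
  fun x => `[< exists2 s : seq (R * R),
    {in s, forall u, u.1 \in I /\ u.2 \in J} & x = \sum_(u <- s) u.1 * u.2 >].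

Lemma ideal_mul_axiom I J : ideal_axiom (ideal_mul_pred I J).
Proof.
have mulP a x : ideal_mul_pred I J x -> ideal_mul_pred I J (a * x).
  move=> /asboolP[s sIJ ->]; apply/asboolP.
  exists [seq (a * u.1, u.2) | u <- s].
    by move=> _ /mapP[u /sIJ[uI uJ] ->]; split => //=; exact: idealMl.
  by rewrite big_map mulr_sumr; apply: eq_bigr => u _; rewrite mulrA.
split=> //; split=> [|x y xIJ]; first by apply/asboolP; exists [::]; rewrite ?big_nil.
move=> /(mulP (-1)) yIJ; rewrite -mulN1r.
move: xIJ yIJ => /asboolP[s sIJ ->] /asboolP[t tIJ ->].
apply/asboolP; exists (s ++ t); last by rewrite big_cat.
by move=> u; rewrite mem_cat => /orP[/sIJ|/tIJ].
Qed.

Definition ideal_mul I J := Ideal (ideal_mul_axiom I J).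

Lemma mem_ideal_mul (I J : ideal) x y : x \in I -> y \in J -> x * y \in ideal_mul I J.
Proof.
move=> xI yJ; apply/asboolP; exists [:: (x, y)]; last by rewrite big_seq1.
by move=> u; rewrite inE => /eqP->.
Qed.

Lemma sub_ideal_mul (I J L : ideal) :
  (forall x y, x \in I -> y \in J -> x * y \in L) ->
  forall z, z \in ideal_mul I J -> z \in L.
Proof.
move=> IJL _ /asboolP[s sIJ ->]; rewrite big_seq_cond.
by apply: rpred_sum => u; rewrite andbT => /sIJ[]; exact: IJL.
Qed.

Lemma ideal_mulC : commutative ideal_mul.
Proof.
by move=> I J; apply: eq_ideal => z; apply/idP/idP; apply: sub_ideal_mul => x y ? ?;
  rewrite mulrC; exact: mem_ideal_mul.
Qed.

Lemma ideal_mulA : associative ideal_mul.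
Proof.
have sub I J L z : z \in ideal_mul I (ideal_mul J L) -> z \in ideal_mul (ideal_mul I J) L.
  apply: sub_ideal_mul => x _ xI /asboolP[s sJL ->]; rewrite mulr_sumr big_seq_cond.
  apply: rpred_sum => u; rewrite andbT => /sJL[uJ uL]; rewrite mulrA.
  by apply: mem_ideal_mul => //; exact: mem_ideal_mul.
move=> I J L; apply: eq_ideal => z; apply/idP/idP; first exact: sub.
rewrite [ideal_mul _ L]ideal_mulC [ideal_mul I J]ideal_mulC => /sub.
by rewrite ideal_mulC [ideal_mul L J]ideal_mulC.
Qed.

Lemma ideal_mul1l : left_id ideal1 ideal_mul.
Proof.
move=> I; apply: eq_ideal => z; apply/idP/idP; last first.
  by rewrite -{2}[z]mul1r; apply: mem_ideal_mul; exact: mem_ideal1.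
by apply: sub_ideal_mul => x y _; exact: idealMl.
Qed.

HB.instance Definition _ :=
  Monoid.isComLaw.Build ideal ideal1 ideal_mul ideal_mulA ideal_mulC ideal_mul1l.

Lemma ideal_mulACA : interchange ideal_mul ideal_mul.
Proof. exact: Monoid.mulmACA. Qed.

Lemma ideal_principalM a b :
  ideal_mul (ideal_principal a) (ideal_principal b) = ideal_principal (a * b).
Proof.
apply: eq_ideal => z; apply/idP/mem_ideal_principal => [|[c ->]]; last first.
  rewrite mulrA; apply: mem_ideal_mul; apply/mem_ideal_principal.
    by exists c.
  by exists 1; rewrite mul1r.
move=> zab; apply/mem_ideal_principal; move: z zab; apply: sub_ideal_mul.
move=> _ _ /mem_ideal_principal[c ->] /mem_ideal_principal[d ->].
by apply/mem_ideal_principal; exists (c * d); rewrite mulrACA.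
Qed.

Definition is_maximal (I : ideal) :=
  I <> ideal1 /\
  forall J : ideal, {subset I <= J} -> J = I \/ J = ideal1.

(* The absolute norm #|R / I|; it is 0 when R / I is infinite. *)
Definition ideal_norm (I : ideal) : nat :=
  #|` fset_set [set: {ideal_quot (ideal_mem I)}] |.

Record nzideal := NzIdeal { nzideal_val :> ideal; nzidealP : nzideal_val <> ideal0 }.

HB.instance Definition _ := gen_eqMixin nzideal.
HB.instance Definition _ := gen_choiceMixin nzideal.

Lemma ideal_neq0P (I : ideal) : I <> ideal0 <-> exists2 x, x \in I & x != 0.
Proof.
split=> [I0|[x xI /eqP x0] I0]; last first.
  by apply: x0; move: xI; rewrite I0 => /mem_ideal_principal[b ->]; rewrite mulr0.
apply: contrapT => nI; apply: I0; apply: eq_ideal => x.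
apply/idP/mem_ideal_principal => [xI|[b ->]]; last by rewrite mulr0 rpred0.
exists 0; rewrite mul0r; apply: contrapT => /eqP x0; apply: nI.
by exists x.
Qed.

Lemma nzideal1_subproof : ideal1 <> ideal0.
Proof. by apply/ideal_neq0P; exists 1; rewrite ?oner_neq0 ?mem_ideal1. Qed.

Lemma nzideal_mul_subproof (I J : nzideal) : ideal_mul I J <> ideal0.
Proof.
have [/ideal_neq0P[x xI x0] /ideal_neq0P[y yJ y0]] := (@nzidealP I, @nzidealP J).
apply/ideal_neq0P; exists (x * y); last by rewrite mulf_neq0.
exact: mem_ideal_mul.
Qed.

Definition nzideal1 := NzIdeal nzideal1_subproof.
Definition nzideal_mul (I J : nzideal) := NzIdeal (@nzideal_mul_subproof I J).

Lemma eq_nzideal (I J : nzideal) : I = J :> ideal -> I = J.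
Proof.
case: I J => [I HI] [J HJ] /= E; case: _ / E HJ => HJ.
by congr NzIdeal; exact: Prop_irrelevance.
Qed.

Definition ideal_equiv : rel nzideal := fun I J =>
  `[< exists a b : R, [/\ a != 0, b != 0 &
        ideal_mul (ideal_principal a) I = ideal_mul (ideal_principal b) J] >].

Lemma ideal_equiv_class : equiv_class_of ideal_equiv.
Proof.
split=> [I|I J|J I L].
- by apply/asboolP; exists 1, 1; rewrite oner_neq0.
- by apply/idP/idP => /asboolP[a [b [a0 b0 E]]]; apply/asboolP; exists b, a.
move=> /asboolP[a [b [a0 b0 E]]] /asboolP[c [d [c0 d0 F]]].
apply/asboolP; exists (c * a), (b * d); split; rewrite ?mulf_neq0 //.
rewrite -!ideal_principalM -!ideal_mulA E -F.
by rewrite ideal_mulA [ideal_mul _ (ideal_principal b)]ideal_mulC ideal_mulA.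
Qed.

Canonical ideal_equiv_rel := EquivRelPack ideal_equiv_class.
Canonical ideal_equiv_encModRel := defaultEncModRel ideal_equiv.

Definition ideal_class := {eq_quot ideal_equiv}.
HB.instance Definition _ := EqQuotient.on ideal_class.
HB.instance Definition _ := Choice.on ideal_class.

Definition class_of (I : nzideal) : ideal_class := \pi_ideal_class I.

Definition ideal_class1 : ideal_class := class_of nzideal1.
Definition ideal_class_mul (x y : ideal_class) : ideal_class :=
  class_of (nzideal_mul (repr x) (repr y)).

Lemma class_ofM I J : class_of (nzideal_mul I J) = ideal_class_mul (class_of I) (class_of J).
Proof.
rewrite /ideal_class_mul; apply/eqmodP.
have [/asboolP[a [b [a0 b0 E]]] /asboolP[c [d [c0 d0 F]]]] :
    ideal_equiv I (repr (class_of I)) /\ ideal_equiv J (repr (class_of J)).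
  by split; apply/eqmodP; rewrite reprK.
apply/asboolP; exists (a * c), (b * d); split; rewrite ?mulf_neq0 //=.
by rewrite -!ideal_principalM ideal_mulACA E F ideal_mulACA.
Qed.

Lemma ideal_class_mulA : associative ideal_class_mul.
Proof.
move=> x y z; rewrite -[x]reprK -[y]reprK -[z]reprK -!/(class_of _) -!class_ofM.
by congr class_of; apply: eq_nzideal; exact: ideal_mulA.
Qed.

Lemma ideal_class_mul1l : left_id ideal_class1 ideal_class_mul.
Proof.
move=> x; rewrite -[x]reprK -!/(class_of _) -class_ofM.
by congr class_of; apply: eq_nzideal; exact: ideal_mul1l.
Qed.

Lemma ideal_class_mulC : commutative ideal_class_mul.
Proof. by move=> x y; congr class_of; apply: eq_nzideal; exact: ideal_mulC. Qed.

Lemma ideal_class_mul1r : right_id ideal_class1 ideal_class_mul.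
Proof. by move=> x; rewrite ideal_class_mulC ideal_class_mul1l. Qed.

(* Ideal classes form a commutative monoid over any domain; they form a group
   when R is a Dedekind domain, in particular when R is a ring of integers. *)
HB.instance Definition _ := isMonoid.Build ideal_class
  ideal_class_mulA ideal_class_mul1l ideal_class_mul1r.

(* The inverse of x, if it exists, is the y such that x * y = 1. *)
Definition class_subgroup (H : set ideal_class) :=
  [/\ H 1%g,
      forall x y, H x -> H y -> H (x * y)%g &
      forall x y, H x -> (x * y)%g = 1%g -> H y].

End Ideals.

Section RingOfIntegers.
Variable K : fieldExtType rat.

Definition integral_pred : {pred K} :=
  fun x => `[< integralOver (intr : int -> K) x >].

Lemma integral_subring : subring_closed integral_pred.
Proof.
split=> [|x y /asboolP Hx /asboolP Hy|x y /asboolP Hx /asboolP Hy]; apply/asboolP.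
- exact: integral1.
- exact: integral_sub.
- exact: integral_mul.
Qed.

HB.instance Definition _ := GRing.isSubringClosed.Build K integral_pred integral_subring.

Record ring_of_integers :=
  RingOfIntegers { int_val : K; int_valP : int_val \in integral_pred }.

HB.instance Definition _ := [isSub for int_val].
HB.instance Definition _ := [Choice of ring_of_integers by <:].
HB.instance Definition _ := [SubChoice_isSubComNzRing of ring_of_integers by <:].

Local Notation OK := ring_of_integers.

Definition OK_unit : pred OK := fun x => `[< exists y : OK, y * x = 1 >].
Definition OK_inv (x : OK) : OK :=
  if pselect (exists y : OK, y * x = 1) is left e then projT1 (cid e) else x.

Lemma OK_mulVr : {in OK_unit, left_inverse 1 OK_inv *%R}.
Proof.
move=> x /asboolP xU; rewrite /OK_inv; case: pselect => // e.
by case: cid.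
Qed.

Lemma OK_unitPl (x y : OK) : y * x = 1 -> OK_unit x.
Proof. by move=> yx; apply/asboolP; exists y. Qed.

Lemma OK_invr_out : {in [predC OK_unit], OK_inv =1 id}.
Proof.
by move=> x; rewrite inE => /asboolP xU; rewrite /OK_inv; case: pselect.
Qed.

HB.instance Definition _ :=
  GRing.ComNzRing_hasMulInverse.Build OK OK_mulVr OK_unitPl OK_invr_out.

Lemma OK_idomain : GRing.integral_domain_axiom OK.
Proof.
move=> x y /(congr1 val); rewrite rmorphM rmorph0 => /eqP; rewrite mulf_eq0.
by rewrite -(rmorph0 (val : ring_of_integers -> K)) !(inj_eq val_inj).
Qed.

HB.instance Definition _ := GRing.ComUnitRing_isIntegral.Build OK OK_idomain.

End RingOfIntegers.

Section Polya.
Variable K : fieldExtType rat.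

Local Notation OK := (ring_of_integers K).

(* The index set is finite, as there are finitely many ideals of a given norm;
   a finitely supported product over an infinite set would be the unit ideal. *)
Definition ostrowski (p f : nat) : ideal OK :=
  \big[@ideal_mul OK/@ideal1 OK]_(m \in [set m : ideal OK |
     is_maximal m /\ ideal_norm m = (p ^ f)%N]) m.

(* The constraint on I only packs the Ostrowski ideal, which is nonzero, as a
   nonzero ideal. *)
Definition polya_group : set (ideal_class OK) :=
  smallest (@class_subgroup OK)
    [set class_of I | I in [set I : nzideal OK | exists p f : nat,
       [/\ prime p, (0 < f)%N & nzideal_val I = ostrowski p f]]].

Definition polya_field := forall p f : nat,
  prime p -> (0 < f)%N -> is_principal (ostrowski p f).

Definition polya_group_isog_Z2 :=
  exists phi : ideal_class OK -> 'Z_2,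
    set_bij polya_group [set: 'Z_2] phi /\
    (forall x y, polya_group x -> polya_group y -> phi (x * y)%g = phi x + phi y).

(* K = Q(sqrt m, sqrt n), up to isomorphism. *)
Definition generated_by_sqrts (m n : nat) := exists a b : K,
  [/\ a ^+ 2 = m%:R, b ^+ 2 = n%:R & <<1 & [:: a; b]>>%VS = {:K}%VS].

End Polya.

(* Meant for p an odd prime: 'F_p is Z/pZ only when p is prime. *)
Definition legendre (a : int) (p : nat) : int :=
  if (a%:~R : 'F_p) == 0 then 0
  else if [exists x : 'F_p, x ^+ 2 == a%:~R] then 1 else -1.

(* Main.v *)
Require Import Defs.
From HB Require Import structures.
From mathcomp Require Import all_boot all_order all_algebra all_field.
From mathcomp Require Import all_solvable.
From mathcomp Require Import finmap.
From mathcomp Require Import boolp classical_sets functions cardinality fsbigop.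
From mathcomp Require Import zify ring lra.

Set Implicit Arguments.
Unset Strict Implicit.
Unset Printing Implicit Defensive.

Import Order.TTheory GRing.Theory Num.Theory.
Local Open Scope ring_scope.

(** Write m = q1 q2 and n = p1 p2 p3, so that K = Q(a, b) with a^2 = m and
    b^2 = n.  Both radicands are 1 modulo 4 and they are coprime, so only the
    five given primes ramify in K.

    Ostrowski ideals.  If an Ostrowski ideal I above p is not the unit ideal, it
    is the intersection of a nonempty family of maximal ideals above p that is
    stable under the Galois group ([ostrowski_radical]).  For x in I the traces
    of the multiples of x are rational integers in I, hence divisible by p, and
    x a b is a combination of such traces with integral coefficients
    ([trace_recover]): so p divides x a b.  If p does not divide m n, this
    forces I = (p); if p divides n, it forces I = (p, b), here written as
    { x | x b / p is integral }, and likewise with a when p divides m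
    ([radical_unramified], [radical_ramified]).  Such a ramified I is principal
    as soon as p times a unit is a square in K ([colon_principal]).

    Squares up to units.  Let S be the group of the d such that d times a unit
    is a square of K.  For D among m, n and m n, the fundamental solution of the
    Pell equation X^2 - D Y^2 = 1 splits into a factorisation D = d e with d <> 1
    and d x^2 - e y^2 = 1 ([pell_split]), and then d is in S, because
    (d x + y sqrt D)^2 is d times a unit ([sqr_up_to_unit_pell]).  The equation
    d x^2 - e y^2 = 1 can hold only if d is a square modulo the primes dividing
    e, and -e a square modulo the primes dividing d ([locally_solubleP]).

    Conclusion.  For D = m these conditions leave only d = q1 and d = q2, so q1
    and q2 are in S.  For D = n they leave one of the p_i or its cofactor, so
    some p_i is in S; since n is in S too, the product of the other two is in S,
    the corresponding classes have order at most 2 and coincide, and the Polya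
    group has at most two elements ([polya_dichotomy]).  In each of the five
    cases the Legendre symbols, compared by quadratic reciprocity, force the
    divisor found for D = m n to be independent, modulo squares and modulo q1 and
    q2, of n and of the divisor found for D = n.  These three classes then span
    the classes of p1, p2, p3, which are therefore all in S ([good_p_all]). *)

(** * Pell's equation and the factorisations it yields *)

Section Pell.
Variable D : nat.
Hypothesis D_nonsquare : forall x : nat, (x ^ 2)%N != D.

(** The triple [(a, h, b)] encodes the indefinite form a X^2 + 2 h X Y - b Y^2
    in a basis whose two vectors take values of opposite signs.  Its value at
    the sum of the two basis vectors is [a + 2 h - b]; a step replaces by that
    sum the basis vector whose value has the same sign.  This is a walk along
    the river of Conway's topograph of the form. *)
Definition river_step (s : int * int * int) : int * int * int :=
  let: (a, h, b) := s in let c := a + h *+ 2 - b in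
  if c < 0 then (a, h + a, - c) else (c, h - b, b).

Definition river_form (s : int * int * int) :=
  let: (a, h, b) := s in [/\ 0 < a, 0 < b & h ^+ 2 + a * b = D%:Z].

Lemma nonsquare_int (x : int) : x ^+ 2 != D%:Z.
Proof.
apply: contra (D_nonsquare `|x|) => /eqP E.
by rewrite -abszX E absz_nat.
Qed.

Lemma river_step_form s : river_form s -> river_form (river_step s).
Proof.
case: s => [[a h] b] /= [a0 b0 E].
have c0 : a + h *+ 2 - b != 0.
  apply: contra (nonsquare_int (a + h)) => /eqP c0; rewrite -E.
  have -> : b = a + h *+ 2 by apply/eqP; rewrite eq_sym -subr_eq0 c0.
  by apply/eqP; ring.
case: ltrP => c1; split => //; try lia.
Qed.

(** The sign of [2 h - (a - b)] in the target tells which of the two kinds of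
    step was taken, so the walk can be run backwards. *)
Lemma river_step_inj s t : river_form s -> river_form t ->
  river_step s = river_step t -> s = t.
Proof.
case: s t => [[a h] b] [[a' h'] b'] /= [a0 b0 _] [a0' b0' _].
case: ltrP => c; case: ltrP => c' [E1 E2 E3].
- by congr (_, _, _); lia.
- by exfalso; lia.
- by exfalso; lia.
- by congr (_, _, _); lia.
Qed.

Definition river k := iter k river_step (1, 0, D%:Z).

Lemma D_gt0 : (0 < D)%N.
Proof. by rewrite lt0n eq_sym; exact: (D_nonsquare 0). Qed.

Lemma river_formP k : river_form (river k).
Proof.
elim: k => [|k IH]; last exact: river_step_form.
by split=> //; [rewrite ltz_nat; exact: D_gt0 | rewrite mul1r expr0n add0r].
Qed.

(** There are finitely many triples with [a, b > 0] and [h^2 + a b = D], so two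
    positions of the walk coincide; injectivity moves the coincidence back to
    the start. *)
Lemma river_cycle : exists2 k, (0 < k)%N & river k = river 0.
Proof.
pose T := ('I_D.+1 * 'I_(D.*2).+1 * 'I_D.+1)%type.
pose code (s : int * int * int) : T :=
  (inord `|s.1.1|, inord `|s.1.2 + D%:Z|, inord `|s.2|).
have codeI s t : river_form s -> river_form t -> code s = code t -> s = t.
  case: s t => [[a h] b] [[a' h'] b'] /= [a0 b0 E] [a0' b0' E'].
  case=> /(congr1 val) /= C1 /(congr1 val) /= C2 /(congr1 val) /= C3.
  have bnd (u v w : int) : 0 < u -> 0 < w -> v ^+ 2 + u * w = D%:Z ->
      [/\ u <= D%:Z, `|v| <= D%:Z & w <= D%:Z].
    by move=> *; split; nia.
  have [? ? ?] := bnd _ _ _ a0 b0 E; have [? ? ?] := bnd _ _ _ a0' b0' E'.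
  by move: C1 C2 C3; rewrite !inordK; try lia; move=> *; congr (_, _, _); lia.
have : ~~ injectiveb (fun i : 'I_#|{: T}|.+1 => code (river i)).
  by apply/negP => /injectiveP/leq_card; rewrite card_ord ltnn.
case/injectivePn=> i [j ij].
move=> /codeI; move/(_ (river_formP _) (river_formP _)).
wlog lt_ij : i j ij / (i < j)%N.
  move=> W E; have := ij; rewrite -val_eqE neq_ltn => /orP[lt|lt].
    exact: (W i j).
  by apply: (W j i) => //; rewrite eq_sym.
move=> E; exists (j - i)%N; first by rewrite subn_gt0.
have {E} : river (0 + i) = river ((j - i) + i) by rewrite add0n subnK // ltnW.
move: (j - i)%N => l; elim: (nat_of_ord i) => [|k IH]; first by rewrite !addn0.
rewrite !addnS => E; apply: IH.
exact: river_step_inj (river_formP _) (river_formP _) E.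
Qed.

(** The basis reached after [k] steps, in terms of the original one.  The bound
    on its entries ensures that it is not the original basis when [k > 0]. *)
Lemma river_matrix k : exists x y z w : int,
  [/\ [/\ 0 <= x, 0 <= y, 0 <= z & 0 <= w], x * w - y * z = 1,
      river k = (x ^+ 2 - D%:Z * y ^+ 2, x * z - D%:Z * y * w,
                 D%:Z * w ^+ 2 - z ^+ 2) &
      k.+2%:Z <= x + y + z + w].
Proof.
elim: k => [|k [x [y [z [w [[x0 y0 z0 w0] det E le_k]]]]]].
  by exists 1, 0, 0, 1; split=> //; rewrite /river /=; congr (_, _, _); ring.
have xy : 0 < x + y by nia.
have zw : 0 < z + w by nia.
rewrite [river _]/(river_step (river k)) E /=.
case: ltrP => _.
  exists x, y, (x + z), (y + w); split; [by split; lia|by rewrite -det; ring| |by lia].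
  by congr (_, _, _); ring.
exists (x + z), (y + w), z, w; split; [by split; lia|by rewrite -det; ring| |by lia].
by congr (_, _, _); ring.
Qed.

(** A return of the river to its starting form is an automorphism of
    X^2 - D Y^2, whose first column is a solution; it is nontrivial because the
    basis has grown. *)
Lemma pell : exists x y : nat, (x ^ 2 = D * y ^ 2 + 1)%N /\ (0 < y)%N.
Proof.
have [k k0 Ek] := river_cycle.
have [x [y [z [w [[x0 y0 z0 w0] det E le_k]]]]] := river_matrix k.
move: E; rewrite Ek => -[E1 E2 _].
exists `|x|%N, `|y|%N; split.
  have : (`|x| ^ 2)%N%:Z = (D * `|y| ^ 2 + 1)%N%:Z.
    rewrite PoszD PoszM -!abszX !abszE !ger0_norm ?sqr_ge0 //.
    by move/esym/eqP: E1; rewrite subr_eq => /eqP ->; rewrite addrC.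
  by case.
rewrite absz_gt0; apply: contraTneq le_k => y00; move: E1 E2 det.
rewrite y00; nia.
Qed.

(** In the solution X^2 - 1 = D Y^2 with least Y > 0 write X = 2 k + 1 and
    Y = 2 t.  Then k (k + 1) = D t^2 with coprime factors on the left, so k + 1
    and k are squares up to complementary divisors d and e of D.  The value
    d = 1 would give a smaller solution. *)
Lemma pell_split : (D %% 4 = 1)%N ->
  exists d e x y : nat, [/\ (d * e = D)%N, (d * x ^ 2 = e * y ^ 2 + 1)%N & d <> 1%N].
Proof.
move=> D4.
pose P Y := (0 < Y)%N && [exists X : 'I_(D * Y ^ 2 + 2), (X ^ 2 == D * Y ^ 2 + 1)%N].
have PP X Y : (X ^ 2 = D * Y ^ 2 + 1)%N -> (0 < Y)%N -> P Y.
  move=> E Y0; rewrite /P Y0; apply/existsP.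
  have lt : (X < D * Y ^ 2 + 2)%N by nia.
  by exists (Ordinal lt); apply/eqP.
have exP : exists Y, P Y by have [X [Y [E Y0]]] := pell; exists Y; exact: PP E Y0.
case: (ex_minnP exP) => Y /andP[Y0 /existsP[[X _] /= /eqP E]] minY.
(* Y odd would give X^2 = 1 + D = 2 modulo 4. *)
have [k [t [EX EY]]] : exists k t, X = (k.*2.+1)%N /\ Y = t.*2.
  exists X./2, Y./2.
  have := odd_double_half X; have := odd_double_half Y.
  have DE := divn_eq D 4; rewrite D4 in DE.
  move: E; case: (odd X); case: (odd Y) => /= E H1 H2.
  - by exfalso; nia.
  - by lia.
  - by exfalso; nia.
  - by exfalso; nia.
have Ek : (k.+1 * k = D * t ^ 2)%N by nia.
pose d := gcdn D k.+1.
have d0 : (0 < d)%N by rewrite gcdn_gt0 orbT.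
have [u Eu] : exists u, k.+1 = (u * d)%N by apply/dvdnP; exact: dvdn_gcdr.
have [e Ee] : exists e, D = (e * d)%N by apply/dvdnP; exact: dvdn_gcdl.
have cop_eu : coprime e u.
  have : gcdn (e * d) (u * d) = d by rewrite -Ee -Eu.
  rewrite -muln_gcdl -{2}[d]mul1n => /eqP.
  by rewrite eqn_pmul2r.
have Eku : (u * k = e * t ^ 2)%N.
  by apply/eqP; rewrite -(eqn_pmul2l d0); apply/eqP; nia.
have [w Ew] : exists w, k = (w * e)%N.
  apply/dvdnP; rewrite -(Gauss_dvdr _ cop_eu) Eku; exact: dvdn_mulr.
have e0 : (0 < e)%N by have := D_gt0; rewrite Ee muln_gt0 => /andP[].
have Euw : (u * w = t ^ 2)%N.
  by apply/eqP; rewrite -(eqn_pmul2l e0); apply/eqP; nia.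
have cop_uw : coprime u w.
  have : coprime k.+1 k by rewrite coprimeSn.
  by rewrite Eu Ew coprimeMl !coprimeMr => /andP[/andP[]].
have sq v v' : coprime v v' -> (v * v' = t ^ 2)%N -> (gcdn v t ^ 2 = v)%N.
  move=> cop Ev; rewrite -mulnn muln_gcdr !muln_gcdl.
  rewrite [(t * t)%N]mulnn -Ev [(t * v)%N]mulnC -!muln_gcdr -[RHS]muln1.
  congr (_ * _)%N.
  apply/eqP; rewrite -/(coprime _ _); apply: coprime_dvdl (dvdn_gcdl _ _) _.
  by apply: coprime_dvdr (dvdn_gcdr _ _) _.
exists d, e, (gcdn u t), (gcdn w t).
rewrite (sq u w) // (sq w u) ?[coprime w u]coprime_sym //; last by rewrite mulnC.
split; [by rewrite mulnC | by nia |].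
move=> d1; have : (gcdn u t ^ 2 = D * gcdn w t ^ 2 + 1)%N.
  rewrite (sq u w) // (sq w u) ?[coprime w u]coprime_sym //; last by rewrite mulnC.
  nia.
have [w0|w0] := posnP (gcdn w t); first by move/eqP: w0; rewrite eqn0Ngt gcdn_gt0; lia.
move=> /PP/(_ w0)/minY.
have : (gcdn w t <= t)%N by apply: dvdn_leq; [lia | exact: dvdn_gcdr].
lia.
Qed.
End Pell.

(** * Quadratic reciprocity *)

Section QuadraticCharacter.
Variable F : finFieldType.

(** The quadratic character; for F = 'F_p it is the Legendre symbol. *)
Definition qchar (x : F) : int :=
  if x == 0 then 0 else if [exists y : F, y ^+ 2 == x] then 1 else -1.

Lemma finField_prim_root : {z : F | #|F|.-1.-primitive_root z}.
Proof.
have F1 := finNzRing_gt1 F.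
pose rs := enum (predC1 (0 : F)).
have : has #|F|.-1.-primitive_root rs.
  apply: has_prim_root; first by rewrite -subn1 subn_gt0.
  - apply/allP => x; rewrite mem_enum unity_rootE inE => x0.
    by rewrite -(inj_eq (mulfI x0)) -exprS prednK ?expf_card ?mulr1 // ltnW.
  - exact: enum_uniq.
  by rewrite -cardE cardC1.
by move=> /hasP/sig2W[z _ zP]; exists z.
Qed.

Hypothesis F_odd : odd #|F|.

Let card_half : #|F|.-1 = #|F|./2.*2.
Proof. by have := odd_double_half #|F|; rewrite F_odd; lia. Qed.

(** The power is a square root of 1 and differs from 1, because its exponent is
    positive and smaller than the order of [z]. *)
Lemma prim_root_half (z : F) : #|F|.-1.-primitive_root z ->
  z ^+ #|F|./2 != 1 /\ z ^+ #|F|./2 = -1.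
Proof.
move=> zP; have F1 := finNzRing_gt1 F.
have N1 : z ^+ #|F|./2 != 1.
  rewrite -(prim_order_dvd zP) card_half; apply/negP => /dvdn_leq.
  by move: F1 F_odd card_half; case: #|F| => [|[|n]]; lia.
split=> //; apply/eqP; move: N1.
have : (z ^+ #|F|./2) ^+ 2 == 1.
  by rewrite -exprM muln2 -card_half prim_expr_order.
by rewrite sqrf_eq1 => /orP[->|->].
Qed.

Lemma finField_neq1N1 : (-1 : F) != 1.
Proof.
by have [z /prim_root_half[N1 E]] := finField_prim_root; rewrite -E.
Qed.

Lemma qchar_euler (x : F) : (qchar x)%:~R = x ^+ #|F|./2 :> F.
Proof.
have F1 := finNzRing_gt1 F.
have half0 : (0 < #|F|./2)%N by rewrite half_gt0.
rewrite /qchar; have [->|x0] := eqVneq; first by rewrite expr0n eqn0Ngt half0.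
have [z zP] := finField_prim_root.
have unit_exp (y : F) : y != 0 -> y ^+ #|F|.-1 = 1.
  move=> y0; apply: (mulfI y0).
  by rewrite -exprS prednK ?expf_card ?mulr1 // ltnW.
have [k xE] := prim_rootP zP (unit_exp x x0).
have [_ zh] := prim_root_half zP.
case: existsP => [[y /eqP yx]|nsq] /=.
  rewrite -yx -exprM mul2n -card_half unit_exp //.
  by apply: contraNneq x0 => y0; rewrite -yx y0 expr0n.
case: (boolP (odd k)) => kodd; last first.
  case: nsq; exists (z ^+ k./2); rewrite -exprM muln2 even_halfK //.
  by rewrite xE.
by rewrite xE exprAC zh -signr_odd kodd.
Qed.

Lemma qchar_cases (x : F) : [\/ qchar x = 0, qchar x = 1 | qchar x = -1].
Proof.
rewrite /qchar; case: eqP => _; first by constructor 1.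
by case: existsP => _; [constructor 2 | constructor 3].
Qed.

(** Identities between signs may be checked in any ring where -1 differs
    from 1. *)
Lemma intr_sign_inj (R : nzRingType) (x y : int) : (-1 : R) != 1 ->
  [\/ x = 0, x = 1 | x = -1] -> [\/ y = 0, y = 1 | y = -1] ->
  x%:~R = y%:~R :> R -> x = y.
Proof.
have o0 : (1 == 0 :> R) = false := negbTE (oner_neq0 R).
move=> N1 [] -> [] -> //= /eqP; rewrite ?mulr0z ?mulr1z ?mulrN1z.
- by rewrite eq_sym o0.
- by rewrite eq_sym oppr_eq0 o0.
- by rewrite o0.
- by rewrite eq_sym (negbTE N1).
- by rewrite oppr_eq0 o0.
by rewrite (negbTE N1).
Qed.

Lemma qcharM : {morph qchar : x y / x * y}.
Proof.
move=> x y; apply: (intr_sign_inj finField_neq1N1); first exact: qchar_cases.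
  case: (qchar_cases x) => ->; case: (qchar_cases y) => ->;
  by [constructor 1|constructor 2|constructor 3].
by rewrite rmorphM /= !qchar_euler exprMn.
Qed.

Lemma qchar_sqr x : qchar x ^+ 2 = (x != 0)%:R.
Proof.
rewrite /qchar; case: eqP => _ //=.
by case: existsP => _; rewrite ?sqrrN expr1n.
Qed.

(** Multiplying the variable by a non-residue changes the sign of the sum. *)
Lemma qchar_sum : \sum_x qchar x = 0.
Proof.
have [z zP] := finField_prim_root.
have z0 : z != 0.
  apply: contraTneq (zP) => ->; apply/negP => /prim_expr_order/eqP.
  by rewrite expr0n; have := finNzRing_gt1 F; case: #|F| => [|[|n]] //= _;
     rewrite eq_sym oner_eq0.
have qz : qchar z = -1.
  apply: (intr_sign_inj finField_neq1N1); first exact: qchar_cases.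
    by constructor 3.
  by rewrite qchar_euler (prim_root_half zP).2 mulrN1z.
have : \sum_x qchar x = - \sum_x qchar x.
  rewrite {1}(reindex_inj (mulfI z0)) /= -sumrN; apply: eq_bigr => x _.
  by rewrite qcharM qz mulN1r.
lia.
Qed.

End QuadraticCharacter.

Section GaussSum.
Variables (p : nat) (L : fieldType) (zeta : L).
Hypotheses (p_pr : prime p) (p_odd : odd p) (zetaP : p.-primitive_root zeta).

Let Fp_odd : odd #|'F_p|. Proof. by rewrite card_Fp. Qed.

Definition add_char (t : 'F_p) : L := zeta ^+ t.

Lemma add_charD s t : add_char (s + t) = add_char s * add_char t.
Proof.
rewrite /add_char /= -exprD -[RHS](prim_expr_mod zetaP).
by congr (_ ^+ (_ %% _)); rewrite Fp_cast.
Qed.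

Lemma add_char0 : add_char 0 = 1.
Proof. by rewrite /add_char expr0. Qed.

Lemma add_char1 : add_char 1 != 1.
Proof.
rewrite /add_char -(prim_order_dvd zetaP) /= modn_small; last by rewrite Fp_cast ?prime_gt1.
by rewrite dvdn1; apply: contraTneq p_pr => ->.
Qed.

Lemma add_charMn t n : add_char (t *+ n) = add_char t ^+ n.
Proof. by elim: n => [|n IH]; rewrite ?mulr0n ?add_char0 // mulrS exprS add_charD IH. Qed.

Lemma add_char_sum u : \sum_t add_char (t * u) = (if u == 0 then p else 0%N)%:R.
Proof.
case: eqP => [->|/eqP u0].
  under eq_bigr do rewrite mulr0 add_char0.
  by rewrite sumr_const card_Fp.
rewrite -(reindex_inj (mulIf u0) (P := xpredT) (F := add_char)) /=.
have : \sum_t add_char t * add_char 1 = \sum_t add_char t.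
  rewrite [RHS](reindex_inj (addIr 1)) /=.
  by apply: eq_bigr => t _; rewrite add_charD.
rewrite -mulr_suml => /eqP; rewrite -subr_eq0 -{2}[\sum_t _]mulr1 -mulrBr mulf_eq0.
by rewrite subr_eq0 (negbTE add_char1) orbF => /eqP.
Qed.

Definition gauss_sum : L := \sum_(t : 'F_p) (qchar t)%:~R * add_char t.

(** Substituting t = s u in the double sum isolates a sum of additive
    characters over s, which vanishes unless u = -1. *)
Lemma gauss_sum_sqr : gauss_sum ^+ 2 = (qchar (-1 : 'F_p))%:~R * p%:R.
Proof.
rewrite expr2 {1}/gauss_sum mulr_suml.
transitivity (\sum_(s : 'F_p) \sum_(u : 'F_p) (s != 0)%:R * (qchar u)%:~R * add_char (s * (u + 1))).
  apply: eq_bigr => s _; have [->|s0] := eqVneq s 0.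
    rewrite /qchar eqxx !mul0r big1 // => u _; by rewrite !mul0r.
  rewrite /gauss_sum (reindex_inj (mulfI s0)) /= mulr_sumr; apply: eq_bigr => u _.
  rewrite mulrACA -add_charD mulrDr mulr1 addrC qcharM // mul1r -rmorphM /=.
  by rewrite mulrA -expr2 qchar_sqr // s0 mul1r.
rewrite exchange_big /=.
transitivity (\sum_(u : 'F_p) (qchar u)%:~R * ((if u + 1 == 0 then p else 0%N)%:R - 1) : L).
  apply: eq_bigr => u _; rewrite -add_char_sum.
  rewrite (bigD1 (0 : 'F_p)) //= [in RHS](bigD1 (0 : 'F_p)) //= !mul0r add_char0 add0r.
  rewrite addrAC subrr add0r mulr_sumr.
  by apply: eq_bigr => s s0; rewrite s0 mul1r.
under eq_bigr do rewrite mulrBr mulr1.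
rewrite big_split /= sumrN -rmorph_sum /= qchar_sum // rmorph0 subr0.
rewrite (bigD1 (-1)) //= addNr eqxx big1 ?addr0 // => u u1.
by rewrite addr_eq0 (negbTE u1) mulr0.
Qed.

(** The Frobenius endomorphism raises the additive character to the power q,
    which amounts to rescaling the summation variable by q. *)
Lemma gauss_sum_expn q : q \in [pchar L] -> odd q ->
  gauss_sum ^+ q = (qchar (q%:R : 'F_p))%:~R * gauss_sum.
Proof.
move=> qL q_odd; rewrite -(pFrobenius_autE qL) rmorph_sum /=.
have q0 : q%:R != 0 :> 'F_p.
  rewrite -(dvdn_pcharf (pchar_Fp p_pr)) (dvdn_prime2 p_pr (pcharf_prime qL)).
  by apply: contraTneq qL => <-; rewrite (prim_root_pcharF zetaP).
rewrite [in RHS]/gauss_sum [in RHS](reindex_inj (mulfI q0)) mulr_sumr /=.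
apply: eq_bigr => t _; rewrite mulrA -rmorphM /= qcharM // mulrA -expr2 qchar_sqr // q0 mul1r.
rewrite rmorphM /= !pFrobenius_autE mulr_natl add_charMn; congr (_ * _).
case: (qchar_cases t) => ->; rewrite ?rmorph0 ?rmorph1 ?rmorphN1 ?expr1n //.
  by rewrite expr0n; case: q {q0} q_odd qL.
by rewrite -signr_odd q_odd.
Qed.
End GaussSum.

Section Reciprocity.

Lemma legendre_qchar (a : int) (p : nat) : legendre a p = qchar (a%:~R : 'F_p).
Proof. by []. Qed.

Lemma legendreN1 (p : nat) : prime p -> odd p -> legendre (-1) p = (-1) ^+ p./2.
Proof.
move=> p_pr p_odd; have Fp : odd #|'F_p| by rewrite card_Fp.
apply: (intr_sign_inj (finField_neq1N1 Fp)); first exact: qchar_cases.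
  by rewrite -signr_odd; case: odd; [constructor 3 | constructor 2].
by rewrite legendre_qchar qchar_euler // rmorphXn /= card_Fp // mulrN1z.
Qed.

Lemma legendreM (p : nat) (x y : int) : prime p -> odd p ->
  legendre (x * y) p = legendre x p * legendre y p.
Proof.
move=> p_pr p_odd; rewrite !legendre_qchar rmorphM /= qcharM //.
by rewrite card_Fp.
Qed.

Lemma legendre1 (p : nat) : legendre 1 p = 1.
Proof.
rewrite legendre_qchar /qchar oner_eq0; case: existsP => // -[].
by exists 1; rewrite expr1n.
Qed.

Lemma legendreX (p n : nat) (x : int) : prime p -> odd p ->
  legendre (x ^+ n) p = legendre x p ^+ n.
Proof.
move=> p_pr p_odd; elim: n => [|n IH]; first by rewrite !expr0 legendre1.
by rewrite !exprS legendreM // IH.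
Qed.

(** In a finite field of characteristic q containing the p-th roots of unity,
    compute the q-th power of the Gauss sum twice: by Frobenius it is multiplied
    by the symbol of q modulo p, and from the value of its square it is
    multiplied by the symbol of (-1 | p) p modulo q. *)
Theorem quadratic_reciprocity (p q : nat) : prime p -> prime q -> odd p -> odd q ->
  p != q -> legendre p q = (-1) ^+ (p./2 * q./2) * legendre q p.
Proof.
move=> p_pr q_pr p_odd q_odd pq.
have Fp_odd : odd #|'F_p| by rewrite card_Fp.
have Fq_odd : odd #|'F_q| by rewrite card_Fp.
have copqp : coprime q p by rewrite prime_coprime // dvdn_prime2 // eq_sym.
have p1 : (0 < p.-1)%N by rewrite -subn1 subn_gt0 prime_gt1.
have [L qL cardL] := pPrimePowerField q_pr p1.
have [z zP] := finField_prim_root L.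
have pL : (p %| #|L|.-1)%N.
  rewrite -subn1 cardL -eqn_mod_dvd ?expn_gt0 ?prime_gt0 //.
  by rewrite -(totient_prime p_pr) Euler_exp_totient.
have [zeta zetaP] : {zeta : L | p.-primitive_root zeta}.
  by exists (z ^+ (#|L|.-1 %/ p)); exact: dvdn_prim_root.
pose c : int := qchar (-1 : 'F_p) * p%:Z.
have gE : gauss_sum p zeta ^+ 2 = c%:~R.
  by rewrite gauss_sum_sqr // /c rmorphM.
have c0 : c%:~R != 0 :> L.
  rewrite /c rmorphM /= mulf_neq0 //.
    have := qchar_sqr (-1 : 'F_p); rewrite oppr_eq0 oner_eq0 /=.
    by case: (qchar_cases (-1 : 'F_p)) => -> //; rewrite ?rmorphN ?oppr_eq0 oner_eq0.
  by rewrite -(dvdn_pcharf qL) -prime_coprime.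
have g0 : gauss_sum p zeta != 0.
  by apply: contraNneq c0 => g0; rewrite -gE g0 expr0n.
have qE : q = q./2.*2.+1 by have := odd_double_half q; rewrite q_odd; lia.
have : (c ^+ q./2)%:~R = (qchar (q%:R : 'F_p))%:~R :> L.
  apply: (mulIf g0); rewrite -gauss_sum_expn //.
  have -> : gauss_sum p zeta ^+ q = gauss_sum p zeta ^+ q./2.*2.+1 by rewrite -qE.
  by rewrite exprSr -mul2n exprM gE rmorphXn.
move=> /eqP; rewrite -subr_eq0 -rmorphB /= -(dvdz_pcharf qL).
rewrite (dvdz_pcharf (pchar_Fp q_pr)) rmorphB subr_eq0 /= => /eqP.
have -> : (c ^+ q./2)%:~R = (legendre c q)%:~R :> 'F_q.
  by rewrite legendre_qchar qchar_euler // card_Fp // rmorphXn.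
move=> /(intr_sign_inj (finField_neq1N1 Fq_odd)) E.
have {}E : legendre c q = legendre q p.
  rewrite [RHS]legendre_qchar; apply: E; exact: qchar_cases.
have qN1 : qchar (-1 : 'F_p) = (-1) ^+ p./2 by rewrite -legendreN1 // legendre_qchar rmorphN1.
rewrite -E legendreM // qN1.
rewrite legendreX // legendreN1 // -exprM [(q./2 * _)%N]mulnC.
by rewrite mulrA -expr2 sqrr_sign mul1r.
Qed.
End Reciprocity.

(** * Local conditions on a factorisation of a radicand *)

Definition nonres (a p : nat) : bool := legendre a p == -1.

Lemma legendre_nonres a p : prime p -> ~~ (p %| a)%N ->
  legendre a p = (-1) ^+ nonres a p.
Proof.
move=> p_pr pa; rewrite /nonres /legendre.
rewrite -(dvdn_pcharf (pchar_Fp p_pr)) (negbTE pa).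
by case: ifP.
Qed.

Lemma nonres_recip p q : prime p -> prime q -> odd p -> odd q -> p != q ->
  nonres p q = nonres q p (+) (odd p./2 && odd q./2).
Proof.
move=> p_pr q_pr p_odd q_odd pq; have := quadratic_reciprocity p_pr q_pr p_odd q_odd pq.
rewrite !legendre_nonres ?dvdn_prime2 //; last by rewrite eq_sym.
rewrite -[_ ^+ (_ * _)]signr_odd oddM -signr_addb => /signr_inj ->; by rewrite addbC.
Qed.

(** For D the product of [ps] and d the product of the members of [ps] that
    satisfy [P], this expresses that d x^2 - (D / d) y^2 = 1 is not ruled out
    modulo a prime of [ps].  Exclusive-ors of non-residue bits stand for products
    of Legendre symbols, and [odd q./2] is the bit of -1. *)
Definition locally_soluble (ps : seq nat) (P : pred nat) : bool :=
  all (fun q => if P q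
     then \big[addb/false]_(p <- ps | ~~ P p) nonres p q == odd q./2
     else ~~ \big[addb/false]_(p <- ps | P p) nonres p q) ps.

Lemma dvd_prod_primes ps d : uniq ps -> all prime ps -> (d %| \prod_(p <- ps) p)%N ->
  d = (\prod_(p <- ps | (p %| d)%N) p)%N.
Proof.
elim: ps d => [|p ps IH] d /=; first by rewrite !big_nil dvdn1 => _ _ /eqP.
move=> /andP[pps ups] /andP[p_pr ps_pr]; rewrite !big_cons => dp.
have cop : coprime p (\prod_(q <- ps) q).
  rewrite big_seq; apply: (big_ind (coprime p)); first by rewrite coprimen1.
    by move=> x y cx cy; rewrite coprimeMr cx cy.
  move=> q qps; rewrite prime_coprime // dvdn_prime2 //; last exact: (allP ps_pr).
  by apply: contraNneq pps => ->.
case: ifP => pd.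
  have [d' dE] := dvdnP pd.
  have p0 := prime_gt0 p_pr.
  have d'ps : (d' %| \prod_(q <- ps) q)%N by rewrite -(dvdn_pmul2l p0) [(p * d')%N]mulnC -dE.
  rewrite dE mulnC {1}(IH d' ups ps_pr d'ps); congr (_ * _)%N.
  rewrite big_seq_cond [RHS]big_seq_cond; apply: eq_bigl => q.
  case: (boolP (q \in ps)) => //= qps; rewrite Euclid_dvdM ?(allP ps_pr) //.
  rewrite (@dvdn_prime2 q p) ?(allP ps_pr q) //; case: (eqVneq q p) => [qp|_]; last by [].
  by rewrite -qp qps in pps.
apply: IH => //; rewrite -(@Gauss_dvdr _ p) //.
by rewrite coprime_sym prime_coprime // pd.
Qed.

Lemma dvdn_prod_primes ps q (P : pred nat) : prime q -> all prime ps ->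
  (q %| \prod_(p <- ps | P p) p)%N = (q \in ps) && P q.
Proof.
move=> q_pr; elim: ps => [|p ps IH] /=; first by rewrite big_nil dvdn1 gtn_eqF ?prime_gt1.
move=> /andP[p_pr /IH {}IH]; rewrite big_cons inE; case: ifP => Pp.
  rewrite Euclid_dvdM // dvdn_prime2 // IH.
  by case: (eqVneq q p) => [->|] //=; rewrite Pp.
by rewrite IH; case: (eqVneq q p) => [->|] //=; rewrite Pp andbF.
Qed.

Lemma legendre_prod ps q (P : pred nat) : prime q -> odd q -> all prime ps ->
  ~~ ((q \in ps) && P q) ->
  legendre (\prod_(p <- ps | P p) p)%N q =
  (-1) ^+ (\big[addb/false]_(p <- ps | P p) nonres p q).
Proof.
move=> q_pr q_odd; elim: ps => [|p ps IH] /=; first by rewrite !big_nil legendre1.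
move=> /andP[p_pr /IH {}IH]; rewrite inE !big_cons; case: ifP => Pp.
  rewrite andb_orl negb_or => /andP[qp /IH E].
  rewrite PoszM legendreM // E signr_addb legendre_nonres //.
  by rewrite dvdn_prime2 //; apply: contra qp => /eqP->; rewrite eqxx Pp.
by move=> H; apply: IH; apply: contra H => /andP[-> ->]; rewrite orbT.
Qed.

Lemma legendre_sqr (x : nat) p : prime p -> odd p -> ~~ (p %| x)%N -> legendre (x ^ 2)%N p = 1.
Proof.
move=> p_pr p_odd px; rewrite -mulnn PoszM legendreM // legendre_nonres //.
by rewrite -expr2 sqrr_sign.
Qed.

Lemma legendre_modz (a b : int) p : prime p -> (p %| a - b)%Z -> legendre a p = legendre b p.
Proof.
move=> p_pr; rewrite (dvdz_pcharf (pchar_Fp p_pr)) rmorphB subr_eq0 /= => /eqP E.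
by rewrite /legendre E.
Qed.

(** Reduce d x^2 = e y^2 + 1 modulo q: if q divides e it says that d is a square,
    and if q divides d it says that -e is a square. *)
Lemma locally_solubleP ps d e x y : uniq ps -> all prime ps -> all odd ps ->
  (d * e = \prod_(p <- ps) p)%N -> (d * x ^ 2 = e * y ^ 2 + 1)%N ->
  locally_soluble ps (fun p => p %| d)%N.
Proof.
move=> ups prs odds dE xyE.
have dD : d = (\prod_(p <- ps | (p %| d)%N) p)%N.
  by apply: dvd_prod_primes => //; rewrite -dE dvdn_mulr.
have d0 : (0 < d)%N.
  rewrite lt0n; apply/eqP => d0; rewrite d0 !mul0n addn1 in xyE; lia.
have eD : e = (\prod_(p <- ps | ~~ (p %| d)%N) p)%N.
  apply/eqP; rewrite -(eqn_pmul2l d0) dE (bigID (fun p => p %| d)%N) /=.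
  by rewrite -dD.
apply/allP => q qps; have q_pr := allP prs q qps; have q_odd := allP odds q qps.
have q1 : ~~ (q %| 1)%N by rewrite dvdn1 gtn_eqF ?prime_gt1.
case: ifP => qd.
  have qe : ~~ (q %| e)%N by rewrite eD dvdn_prod_primes // qd andbF.
  have qy : ~~ (q %| y)%N.
    apply: contra q1 => qy; rewrite -(@dvdn_addr (e * y ^ 2)%N q).
      by rewrite -xyE dvdn_mulr.
    by rewrite dvdn_mull // dvdn_exp.
  have := @legendre_prod ps q (fun p => ~~ (p %| d)%N) q_pr q_odd prs.
  rewrite qps qd -eD => /(_ isT) E1.
  have : legendre (e * y ^ 2)%N q = legendre (-1) q.
    apply: legendre_modz => //; rewrite opprK -[1]/(1%N%:Z) -PoszD -xyE.
    by apply: (@dvdn_mulr q).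
  rewrite PoszM legendreM // legendre_sqr // mulr1 E1 legendreN1 // -[RHS]signr_odd.
  by move=> /signr_inj ->.
have qx : ~~ (q %| x)%N.
  apply: contra q1 => qx; rewrite -(@dvdn_addr (e * y ^ 2)%N q).
    by rewrite -xyE dvdn_mull // dvdn_exp.
  by rewrite dvdn_mulr // eD dvdn_prod_primes // qps qd.
have := @legendre_prod ps q (fun p => (p %| d)%N) q_pr q_odd prs.
rewrite qps qd -dD => /(_ isT) E1.
have : legendre (d * x ^ 2)%N q = legendre 1 q.
  apply: legendre_modz => //; rewrite xyE PoszD addrK.
  by apply: (@dvdn_mulr q); rewrite eD dvdn_prod_primes // qps qd.
rewrite PoszM legendreM // legendre_sqr // mulr1 E1 legendre1.
by rewrite -[1](expr0 (-1)) => /(@signr_inj _ _ false) ->.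
Qed.

(** * Solving the local conditions for five primes *)

Lemma nonsquare_prime_dvd D p : prime p -> (p %| D)%N -> ~~ (p ^ 2 %| D)%N ->
  forall x : nat, (x ^ 2)%N != D.
Proof.
move=> p_pr pD p2D x; apply: contra p2D => /eqP xD.
by move: pD; rewrite -xD Euclid_dvdX // andbT => px; exact: dvdn_exp2r.
Qed.

Lemma prod_primes_nonsquare ps : uniq ps -> all prime ps -> ps != [::] ->
  forall x : nat, (x ^ 2)%N != (\prod_(p <- ps) p)%N.
Proof.
case: ps => // p ps /andP[pps _] /= /andP[p_pr ps_pr] _; rewrite big_cons.
apply: (nonsquare_prime_dvd p_pr); first exact: dvdn_mulr.
rewrite -mulnn dvdn_pmul2l ?prime_gt0 //.
by rewrite (@dvdn_prod_primes ps p xpredT) // (negbTE pps).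
Qed.

(** The exclusion of d = 1 becomes the existence of a prime dividing d. *)
Lemma relation_exists ps : uniq ps -> all prime ps -> all odd ps -> ps != [::] ->
  (\prod_(p <- ps) p %% 4 = 1)%N ->
  exists d e x y : nat, [/\ (d * e = \prod_(p <- ps) p)%N,
     (d * x ^ 2 = e * y ^ 2 + 1)%N,
     d = (\prod_(p <- ps | (p %| d)%N) p)%N,
     locally_soluble ps (fun p => p %| d)%N & has (fun p => p %| d)%N ps].
Proof.
move=> ups prs odds ps0 D4.
have [d [e [x [y [dE xyE d1]]]]] := pell_split (prod_primes_nonsquare ups prs ps0) D4.
have dD : d = (\prod_(p <- ps | (p %| d)%N) p)%N.
  by apply: dvd_prod_primes => //; rewrite -dE dvdn_mulr.
exists d, e, x, y; split=> //; first exact: locally_solubleP dE xyE.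
apply: contraT => /hasPn nd; case: d1; rewrite dD big_seq_cond big1 // => p.
by move=> /andP[/nd/negbTE->].
Qed.

(** Boolean quantification written with a conditional, to decide a closed
    statement about many booleans by evaluation. *)
Definition bool_forall (P : bool -> bool) : bool := if P true then P false else false.

Lemma bool_forall_elim (P : bool -> bool) : bool_forall P -> forall b, P b.
Proof. by rewrite /bool_forall; case E: (P true) => // F []. Qed.

Lemma andb_curry (a b : bool) (C : Prop) : (a && b -> C) -> a -> b -> C.
Proof. by move=> H a1 b1; apply: H; rewrite a1. Qed.

(** In this section [good] stands for membership in the group of rational
    numbers that are squares of K up to units, of which only the two closure
    properties below and Pell's relations are used. *)
Section Good.
Variable good : nat -> Prop.
Hypothesis goodM : forall x y, good x -> good y -> good (x * y)%N.
Hypothesis good_sqr : forall x y, (0 < x)%N -> good (x ^ 2 * y)%N -> good y.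

Lemma good_div x y : (0 < x)%N -> good x -> good (x * y)%N -> good y.
Proof.
move=> x0 gx gxy; apply: (good_sqr x0).
by rewrite -mulnn -mulnA; exact: goodM.
Qed.

Definition xor_closed (S : bool -> bool -> bool -> Prop) :=
  forall u v w u' v' w', S u v w -> S u' v' w' -> S (u (+) u') (v (+) v') (w (+) w').

(** The determinant over F_2 of the rows (1,1,1), (r1,r2,r3), (b1,b2,b3). *)
Definition det3 r1 r2 r3 b1 b2 b3 :=
  (r2 && b3) (+) (r3 && b2) (+) (r1 && b3) (+) (r3 && b1) (+) (r1 && b2) (+) (r2 && b1).

Lemma xor_span S r1 r2 r3 b1 b2 b3 : xor_closed S ->
  S true true true -> S r1 r2 r3 -> S b1 b2 b3 ->
  det3 r1 r2 r3 b1 b2 b3 ->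
  [/\ S true false false, S false true false & S false false true].
Proof.
move=> SX S1 Sr Sb.
have [[H1 H2] H3] := (SX _ _ _ _ _ _ S1 Sr, SX _ _ _ _ _ _ S1 Sb, SX _ _ _ _ _ _ Sr Sb).
have := SX _ _ _ _ _ _ H1 Sb; move: Sr Sb H1 H2 H3.
by move: r1 r2 r3 b1 b2 b3 => [] [] [] [] [] [] //= *; split.
Qed.

Definition mask3 (p1 p2 p3 : nat) (u v w : bool) := good (p1 ^ u * p2 ^ v * p3 ^ w)%N.

(** Adding exponent vectors over F_2 is multiplying the numbers, up to the square
    of the product of the common primes. *)
Lemma mask3_closed p1 p2 p3 : (0 < p1)%N -> (0 < p2)%N -> (0 < p3)%N ->
  xor_closed (mask3 p1 p2 p3).
Proof.
move=> h1 h2 h3 u v w u' v' w' H H'.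
apply: (@good_sqr (p1 ^ (u && u') * p2 ^ (v && v') * p3 ^ (w && w'))%N).
  by rewrite !muln_gt0 !expn_gt0 h1 h2 h3.
have := goodM H H'; congr good.
have E p (a b : bool) : (p ^ a * p ^ b = (p ^ (a && b)) ^ 2 * p ^ (a (+) b))%N.
  by move: a b => [] []; rewrite /= ?expn0 ?expn1 ?exp1n ?muln1 ?mul1n ?mulnn.
transitivity ((p1 ^ u * p1 ^ u') * (p2 ^ v * p2 ^ v') * (p3 ^ w * p3 ^ w'))%N; first ring.
by rewrite !E; ring.
Qed.

Section Relations.
Variables p1 p2 p3 q1 q2 : nat.
Hypotheses (p1_prime : prime p1) (p2_prime : prime p2) (p3_prime : prime p3)
  (q1_prime : prime q1) (q2_prime : prime q2)
  (distinct : uniq [:: p1; p2; p3; q1; q2])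
  (p1_mod4 : (p1 = 3 %[mod 4])%N) (p2_mod4 : (p2 = 3 %[mod 4])%N)
  (q1_mod4 : (q1 = 3 %[mod 4])%N) (q2_mod4 : (q2 = 3 %[mod 4])%N)
  (p3_mod4 : (p3 = 1 %[mod 4])%N).
Hypothesis good_pell : forall d e x y : nat,
  (d * e)%N \in [:: q1 * q2; p1 * p2 * p3; (q1 * q2) * (p1 * p2 * p3)]%N ->
  (d * x ^ 2 = e * y ^ 2 + 1)%N -> good d.
Hypothesis good_qq : good (q1 * q2)%N.
Hypothesis good_ppp : good (p1 * p2 * p3)%N.

Let mod4_half p (b : bool) : (p = 1 + b.*2 %[mod 4])%N -> (odd p = true) * (odd p./2 = b).
Proof.
move=> pr; have E : p = ((p %/ 4).*2 + b).*2.+1.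
  by rewrite {1}(divn_eq p 4) pr modn_small; [lia | case: b {pr}].
by rewrite E /= odd_double uphalf_double oddD odd_double oddb.
Qed.

Let half_p1 := @mod4_half _ true p1_mod4.
Let half_p2 := @mod4_half _ true p2_mod4.
Let half_p3 := @mod4_half _ false p3_mod4.
Let half_q1 := @mod4_half _ true q1_mod4.
Let half_q2 := @mod4_half _ true q2_mod4.

Let prs_q : [/\ uniq [:: q1; q2], all prime [:: q1; q2] & all odd [:: q1; q2]].
Proof.
move: distinct; rewrite /= !inE !negb_or => /and5P[_ _ _ -> _].
by rewrite q1_prime q2_prime half_q1.1 half_q2.1.
Qed.

Let prs_p : [/\ uniq [:: p1; p2; p3], all prime [:: p1; p2; p3] & all odd [:: p1; p2; p3]].
Proof.
move: distinct; rewrite /= !inE !negb_or => /and5P[/and4P[-> -> _ _] /and3P[-> _ _] _ _ _].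
by rewrite p1_prime p2_prime p3_prime half_p1.1 half_p2.1 half_p3.1.
Qed.

Let ps5 := [:: p1; p2; p3; q1; q2].
Let prs_5 : [/\ uniq ps5, all prime ps5 & all odd ps5].
Proof.
by rewrite distinct /= p1_prime p2_prime p3_prime q1_prime q2_prime half_p1.1
  half_p2.1 half_p3.1 half_q1.1 half_q2.1.
Qed.

Let recip p q : p \in ps5 -> q \in ps5 -> p != q ->
  nonres p q = nonres q p (+) (odd p./2 && odd q./2).
Proof.
have [_ prs odds] := prs_5.
by move=> hp hq; apply: nonres_recip; rewrite ?(allP prs) ?(allP odds).
Qed.

Let q_mod4 : (q1 * q2 %% 4 = 1)%N.
Proof. by rewrite -modnMm q1_mod4 q2_mod4. Qed.

Let p_mod4 : (p1 * p2 * p3 %% 4 = 1)%N.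
Proof. by rewrite -modnMm -[(p1 * p2 %% 4)%N]modnMm p1_mod4 p2_mod4 p3_mod4. Qed.

(** For D = q1 q2 the divisor d is not 1, and d = q1 q2 would make -1 a square
    modulo q1. *)
Lemma good_q : good q1 /\ good q2.
Proof.
have [u pr od] := prs_q.
have D4 : (\prod_(p <- [:: q1; q2]) p %% 4 = 1)%N by rewrite !big_cons big_nil muln1 q_mod4.
have [d [e [x [y [dE xy dD]]]]] := relation_exists u pr od isT D4.
have gd : good d.
  by apply: good_pell xy; rewrite dE !big_cons big_nil muln1 inE eqxx.
move=> ok nz; move: gd ok nz; rewrite {1}dD /locally_soluble /= !big_cons !big_nil /=.
clear dD dE xy.
rewrite half_q1.2 half_q2.2 /=.
case: (q1 %| d)%N; case: (q2 %| d)%N => //=; rewrite ?muln1 => gd _ _.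
  by split=> //; exact: good_div (prime_gt0 q1_prime) gd good_qq.
by split=> //; apply: good_div (prime_gt0 q2_prime) gd _; rewrite mulnC.
Qed.

(** For D = p1 p2 p3 the divisor d is neither 1 nor D, the latter because -1 is
    not a square modulo p1.  So d or its cofactor is one of the primes. *)
Lemma good_p_one : [\/ good p1, good p2 | good p3].
Proof.
have [u pr od] := prs_p.
have D4 : (\prod_(p <- [:: p1; p2; p3]) p %% 4 = 1)%N.
  by rewrite !big_cons big_nil muln1 mulnA p_mod4.
have [d [e [x [y [dE xy dD]]]]] := relation_exists u pr od isT D4.
have gd : good d.
  by apply: good_pell xy; rewrite dE !big_cons big_nil muln1 mulnA !inE eqxx orbT.
move=> ok nz; move: gd ok nz; rewrite {1}dD /locally_soluble /= !big_cons !big_nil /=.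
clear dD dE xy.
have gdiv x' y' : prime x' -> prime y' -> forall z, good (x' * y')%N ->
  good (x' * y' * z)%N -> good z.
  move=> /prime_gt0 hx /prime_gt0 hy z gxy gz.
  by apply: good_div _ gxy gz; rewrite muln_gt0 hx.
rewrite half_p1.2 half_p2.2 half_p3.2 /=.
case: (p1 %| d)%N; case: (p2 %| d)%N; case: (p3 %| d)%N => //=; rewrite ?muln1 => gd _ _.
- by constructor 3; apply: (gdiv p1 p2).
- by constructor 2; apply: (gdiv p1 p3) => //; rewrite mulnAC.
- by constructor 1.
- by constructor 1; apply: (gdiv p2 p3) => //; rewrite mulnC mulnA.
- by constructor 2.
- by constructor 3.
Qed.

(** The five lists of conditions on Legendre symbols, with products of symbols
    multiplied out. *)
Definition nonres_case : bool :=
  let c12 := nonres p1 p2 in let c13 := nonres p1 p3 in let c23 := nonres p2 p3 in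
  let qp1 := nonres q1 p1 (+) nonres q2 p1 in
  let qp2 := nonres q1 p2 (+) nonres q2 p2 in
  let ppq1 := nonres p1 q1 (+) nonres p2 q1 in
  let ppq2 := nonres p1 q2 (+) nonres p2 q2 in
  let p3q := nonres p3 q1 && nonres p3 q2 in
  [|| [&& ~~ c12, ~~ c13, c23, p3q, nonres p1 q1, nonres p1 q2 & qp2],
      [&& ~~ c12, c13, ~~ c23, p3q, ~~ nonres p1 q1, ~~ nonres p1 q2 & qp2],
      [&& c13, c23, ~~ nonres p3 q1, nonres p3 q2, ppq1, ppq2 & ~~ qp1],
      [&& c12, ~~ c13, c23, p3q, ~~ ppq1, ~~ ppq2 & qp1] |
      [&& c12, c13, ~~ c23, p3q, nonres p1 q1, nonres p1 q2 & qp2]].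

(** Take the divisor r found for p1 p2 p3 and the divisor b found for the product
    of all five primes, and drop q1 and q2 from the latter.  Once reciprocity has
    expressed all symbols through ten of them, a finite check shows that local
    solubility forces r, b and p1 p2 p3 to be independent modulo squares. *)
Lemma good_p_all : nonres_case -> [/\ good p1, good p2 & good p3].
Proof.
move=> H.
have g0 := (prime_gt0 p1_prime, prime_gt0 p2_prime, prime_gt0 p3_prime,
            prime_gt0 q1_prime, prime_gt0 q2_prime).
have [r1 [r2 [r3 [b1 [b2 [b3 [Sr Sb det]]]]]]] : exists r1 r2 r3 b1 b2 b3,
   [/\ mask3 p1 p2 p3 r1 r2 r3, mask3 p1 p2 p3 b1 b2 b3 & det3 r1 r2 r3 b1 b2 b3].
  have [up prp odp] := prs_p.
  have D4p : (\prod_(p <- [:: p1; p2; p3]) p %% 4 = 1)%N.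
    by rewrite !big_cons big_nil muln1 mulnA p_mod4.
  have [d [e [x [y [dE xy dD ok nz]]]]] := relation_exists up prp odp isT D4p.
  have gd : good d.
    by apply: good_pell xy; rewrite dE !big_cons big_nil muln1 mulnA !inE eqxx orbT.
  have [u5 pr5 od5] := prs_5.
  have D5E : (\prod_(p <- ps5) p = (q1 * q2) * (p1 * p2 * p3))%N.
    by rewrite !big_cons big_nil muln1; ring.
  have D45 : (\prod_(p <- ps5) p %% 4 = 1)%N.
    by rewrite D5E -modnMm q_mod4 p_mod4.
  have [d' [e' [x' [y' [dE' xy' dD' ok' nz']]]]] := relation_exists u5 pr5 od5 isT D45.
  have gd' : good d'.
    by apply: good_pell xy'; rewrite dE' D5E !inE eqxx !orbT.
  exists (p1 %| d)%N, (p2 %| d)%N, (p3 %| d)%N, (p1 %| d')%N, (p2 %| d')%N, (p3 %| d')%N.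
  split.
  - move: gd; rewrite {1}dD !big_cons big_nil /mask3; congr good.
    by case: (p1 %| d)%N; case: (p2 %| d)%N; case: (p3 %| d)%N; rewrite /= ?expn1 ?expn0; ring.
  - have [gq1 gq2] := good_q.
    pose c := (q1 ^ (q1 %| d') * q2 ^ (q2 %| d'))%N.
    have g1 : good 1.
      by apply: (good_div (prime_gt0 q1_prime) gq1); rewrite muln1.
    have gc : good c.
      by apply: goodM; [case: (q1 %| d')%N | case: (q2 %| d')%N].
    apply: good_div gc _; first by rewrite muln_gt0 !expn_gt0 !g0.
    move: gd'; rewrite {1}dD' !big_cons big_nil /c; congr good.
    by case: (p1 %| d')%N; case: (p2 %| d')%N; case: (p3 %| d')%N;
       case: (q1 %| d')%N; case: (q2 %| d')%N; rewrite /= ?expn1 ?expn0; ring.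
  move: H nz ok nz' ok'; rewrite /nonres_case /locally_soluble /= !big_cons !big_nil /=.
  move: distinct; rewrite /= !inE !negb_or.
  case/and5P=> /and4P[n12 n13 n1q1 n1q2] /and3P[n23 n2q1 n2q2] /andP[n3q1 n3q2] nqq _.
  have i1 : p1 \in ps5 by rewrite !inE eqxx.
  have i2 : p2 \in ps5 by rewrite !inE eqxx !orbT.
  have i3 : p3 \in ps5 by rewrite !inE eqxx !orbT.
  have i4 : q1 \in ps5 by rewrite !inE eqxx !orbT.
  have i5 : q2 \in ps5 by rewrite !inE eqxx !orbT.
  rewrite (recip i1 i2 n12) (recip i1 i3 n13) (recip i1 i4 n1q1) (recip i1 i5 n1q2).
  rewrite (recip i2 i3 n23) (recip i2 i4 n2q1) (recip i2 i5 n2q2).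
  rewrite (recip i3 i4 n3q1) (recip i3 i5 n3q2) (recip i4 i5 nqq).
  rewrite half_p1.2 half_p2.2 half_p3.2 half_q1.2 half_q2.2 /=.
(* Turn the goal into a closed boolean statement: the ten independent symbols
   become outermost, the eight divisibility bits innermost. *)
  do 4![apply: andb_curry]; apply/implyP.
  move: (p1 %| d)%N; apply: bool_forall_elim; move: (p2 %| d)%N; apply: bool_forall_elim.
  move: (p3 %| d)%N; apply: bool_forall_elim; move: (p1 %| d')%N; apply: bool_forall_elim.
  move: (p2 %| d')%N; apply: bool_forall_elim; move: (p3 %| d')%N; apply: bool_forall_elim.
  move: (q1 %| d')%N; apply: bool_forall_elim; move: (q2 %| d')%N; apply: bool_forall_elim.
  move: (nonres p2 p1); apply: bool_forall_elim; move: (nonres p3 p1); apply: bool_forall_elim.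
  move: (nonres p3 p2); apply: bool_forall_elim; move: (nonres q1 p1); apply: bool_forall_elim.
  move: (nonres q2 p1); apply: bool_forall_elim; move: (nonres q1 p2); apply: bool_forall_elim.
  move: (nonres q2 p2); apply: bool_forall_elim; move: (nonres q1 p3); apply: bool_forall_elim.
  move: (nonres q2 p3); apply: bool_forall_elim; move: (nonres q2 q1); apply: bool_forall_elim.
  by vm_compute.
have closed := @mask3_closed p1 p2 p3 (prime_gt0 p1_prime) (prime_gt0 p2_prime) (prime_gt0 p3_prime).
have [] := xor_span closed _ Sr Sb det; first by rewrite /mask3 !expn1.
by rewrite /mask3 !expn0 !expn1 !muln1 !mul1n.
Qed.
End Relations.
End Good.

(** * Algebraic integers and conjugations of a biquadratic field *)

(** Z is integrally closed; the fact is read off from the same fact for algebraic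
    integers inside the algebraic numbers. *)
Lemma rat_root_int (p : {poly int}) (q : rat) : p \is monic ->
  root (map_poly intr p) q -> q \is a Num.int.
Proof.
move=> mon_p rq.
have Aq : (ratr q : algC) \in Aint.
  apply: (@root_monic_Aint (map_poly (intr : int -> algC) p)).
  - rewrite (eq_map_poly (g := (ratr : rat -> algC) \o (intr : int -> rat))).
      by rewrite map_poly_comp fmorph_root.
    by move=> z /=; rewrite ratr_int.
  - exact: monic_map.
  by apply/polyOverP => i; rewrite coef_map /= rpred_int.
have /intrP[z zE] := Cint_rat_Aint (Crat_rat q) Aq.
apply/intrP; exists z.
by apply: (fmorph_inj (ratr : rat -> algC)); rewrite /= [LHS]zE [RHS]ratr_int.
Qed.

Lemma nonsquare_rat (k : nat) (q : rat) :
  (forall x : nat, (x ^ 2)%N != k) -> q ^+ 2 != k%:R.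
Proof.
move=> nsq; apply/eqP => qk.
have /intrP[z zE] : q \is a Num.int.
  apply: (@rat_root_int ('X^2 - k%:R%:P)); first by rewrite monicXnsubC.
  rewrite rmorphB /= map_polyXn map_polyC /= /root !hornerE qk.
  by rewrite rmorph_nat subrr.
move/eqP: (nsq `|z|%N); apply; move: qk; rewrite zE -rmorphXn.
by move=> /eqP; rewrite -[k%:R]/(k%:Z%:~R) eqr_int => /eqP/(congr1 absz); rewrite abszX.
Qed.

(** The coefficients of Bezout's identity, so that membership of [u x] and
    [w x] in any additive subgroup gives membership of [x]. *)
Lemma coprime_combination (R : pzRingType) (u w : nat) (x : R) : coprime u w ->
  exists k l : int, x = k%:~R * (u%:R * x) + l%:~R * (w%:R * x).
Proof.
move=> cop; have [k [l E]] := Bezoutz u w; exists k, l.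
rewrite !mulrA -[u%:R]/(u%:Z%:~R) -[w%:R]/(w%:Z%:~R) -!rmorphM -mulrDl -rmorphD /= E.
by rewrite /gcdz /= (eqP cop) mul1r.
Qed.

Section Integers.
Variable K : fieldExtType rat.
Local Notation OI := (integral_pred (K := K)).

Lemma integral_sqr (x : K) : x ^+ 2 \in OI -> x \in OI.
Proof.
move=> /asboolP x2; apply/asboolP.
apply: (@integral_root_monic _ _ _ _ ('X^2 - (x ^+ 2)%:P)).
- by rewrite monicXnsubC.
- by rewrite /root !hornerE subrr.
apply/integral_poly => i; rewrite coefB coefXn coefC.
apply: integral_sub; first exact: integral_nat.
by case: eqP => _ //; exact: integral0.
Qed.

Lemma integral_rat (q : rat) : q%:A \in OI -> q \is a Num.int.
Proof.
move=> /asboolP[p mon_p rp]; apply: (rat_root_int mon_p).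
rewrite -(fmorph_root (in_alg K)) -map_poly_comp /=.
by rewrite (eq_map_poly (g := intr)) // => z /=; rewrite scaler_int.
Qed.

Lemma natr_eq0 (k : nat) : (k%:R == 0 :> K) = (k == 0%N).
Proof. by rewrite -(rmorph_nat (in_alg K)) fmorph_eq0 pnatr_eq0. Qed.

Lemma integral_intr (x : K) (q : rat) : x = q%:A -> x \in OI -> exists z : int, x = z%:~R.
Proof.
move=> -> /integral_rat/intrP[z ->]; exists z.
by rewrite scaler_int.
Qed.

Lemma integral_coprime_div (u w : nat) (x : K) : coprime u w ->
  u%:R * x \in OI -> w%:R * x \in OI -> x \in OI.
Proof.
move=> /(coprime_combination x)[k [l xE]] ux wx; rewrite xE.
have intI (j : int) : j%:~R \in OI by exact: rpred_int.
by apply: rpredD; [exact: rpredM (intI k) ux | exact: rpredM (intI l) wx].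
Qed.

End Integers.

Section Coordinates.
Variable K : fieldExtType rat.
Local Notation OI := (integral_pred (K := K)).
Variables (m n : nat) (a b : K).
Hypotheses (sqr_a : a ^+ 2 = m%:R) (sqr_b : b ^+ 2 = n%:R).
Hypothesis span_ab : <<1 & [:: a; b]>>%VS = {:K}%VS.
Hypothesis m_nonsquare : forall x : nat, (x ^ 2)%N != m.
Hypothesis n_nonsquare : forall x : nat, (x ^ 2)%N != n.
Hypothesis mn_nonsquare : forall x : nat, (x ^ 2)%N != (m * n)%N.

(** Coordinates with respect to the family 1, a, b, a b of K. *)
Definition comb (c : rat * rat * rat * rat) : K :=
  let: (c0, c1, c2, c3) := c in c0%:A + c1%:A * a + c2%:A * b + c3%:A * (a * b).

Definition comb_add (c d : rat * rat * rat * rat) :=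
  let: (c0, c1, c2, c3) := c in let: (d0, d1, d2, d3) := d in
  (c0 + d0, c1 + d1, c2 + d2, c3 + d3).

Definition comb_mul (c d : rat * rat * rat * rat) :=
  let: (c0, c1, c2, c3) := c in let: (d0, d1, d2, d3) := d in
  (c0 * d0 + c1 * d1 * m%:R + c2 * d2 * n%:R + c3 * d3 * (m%:R * n%:R),
   c0 * d1 + c1 * d0 + (c2 * d3 + c3 * d2) * n%:R,
   c0 * d2 + c2 * d0 + (c1 * d3 + c3 * d1) * m%:R,
   c0 * d3 + c3 * d0 + c1 * d2 + c2 * d1).

Let inA (q : rat) : q%:A = in_alg K q. Proof. by []. Qed.

Lemma combD c d : comb (comb_add c d) = comb c + comb d.
Proof.
case: c d => [[[c0 c1] c2] c3] [[[d0 d1] d2] d3]; rewrite /comb /comb_add !inA !rmorphD.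
by ring.
Qed.

Lemma combM c d : comb (comb_mul c d) = comb c * comb d.
Proof.
case: c d => [[[c0 c1] c2] c3] [[[d0 d1] d2] d3].
rewrite /comb /comb_mul !inA !(rmorphD, rmorphM) !rmorph_nat -sqr_a -sqr_b.
by ring.
Qed.

(** Combinations of 1, a, b, a b are closed under addition and multiplication,
    hence contain all polynomials in a and b. *)
Lemma comb_surj x : exists c, x = comb c.
Proof.
have combA q : exists c, q%:A = comb c.
  by exists (q, 0, 0, 0); rewrite /comb !inA !rmorph0; ring.
have adj (E : {subfield K}) (u : K) : (exists c, u = comb c) ->
    (forall y, y \in E -> exists c, y = comb c) ->
    forall y, y \in <<E; u>>%VS -> exists c, y = comb c.
  move=> [cu uE] EP _ /Fadjoin_polyP[p /polyOverP pE ->].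
  rewrite horner_coef; apply: (big_ind (fun y => exists c, y = comb c)).
  - by have := combA 0; rewrite inA rmorph0.
  - by move=> y z [cy ->] [cz ->]; exists (comb_add cy cz); rewrite combD.
  move=> i _; have [ci ->] := EP _ (pE i).
  have [cX ->] : exists c, u ^+ i = comb c.
    elim: (nat_of_ord i) => [|j [cj IH]]; first by have := combA 1; rewrite inA rmorph1.
    by exists (comb_mul cu cj); rewrite exprS IH uE combM.
  by exists (comb_mul ci cX); rewrite combM.
have : x \in <<1 & [:: a; b]>>%VS by rewrite span_ab memvf.
rewrite adjoin_cons adjoin_seq1.
apply: (adj _ _); first by exists (0, 0, 1, 0); rewrite /comb !inA !rmorph0 rmorph1; ring.
apply: (adj _ _); first by exists (0, 1, 0, 0); rewrite /comb !inA !rmorph0 rmorph1; ring.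
by move=> y /vlineP[q ->].
Qed.

Lemma lin_a_eq0 (x y : rat) : x%:A + y%:A * a = 0 -> x = 0 /\ y = 0.
Proof.
rewrite !inA => E; have y0 : y = 0.
  apply/eqP/contraT => y0; have := nonsquare_rat (- (x / y)) m_nonsquare.
  suff -> : (- (x / y)) ^+ 2 = m%:R by rewrite eqxx.
  apply: (fmorph_inj (in_alg K)); rewrite rmorph_nat -sqr_a rmorphXn rmorphN fmorph_div.
  have yK : in_alg K y != 0 by rewrite fmorph_eq0.
  have /eqP -> : a == - (in_alg K x / in_alg K y); last by [].
  by rewrite -(inj_eq (mulfI yK)) -subr_eq0; apply/eqP; rewrite -[RHS]E; field.
split=> //; apply: (fmorph_inj (in_alg K)); rewrite rmorph0 -[RHS]E y0 rmorph0; ring.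
Qed.

(** Multiplying c2 + c3 a by its conjugate c2 - c3 a gives its norm N.  If N is
    nonzero, b lies in Q + Q a, and squaring shows that n or m n is a rational
    square; if N = 0, the relation only involves 1 and a. *)
Lemma comb_eq0 c : comb c = 0 -> c = (0, 0, 0, 0).
Proof.
case: c => [[[c0 c1] c2] c3] /=.
have [/eqP c20|c20] := eqVneq (c2 ^+ 2 - m%:R * c3 ^+ 2) 0.
  have [c2E c3E] : c2 = 0 /\ c3 = 0.
    have [c30|c30] := eqVneq c3 0.
      by move: c20; rewrite c30 expr0n mulr0 subr0 sqrf_eq0 => /eqP.
    have := nonsquare_rat (c2 / c3) m_nonsquare; rewrite expr_div_n.
    have -> : c2 ^+ 2 = m%:R * c3 ^+ 2 by apply/eqP; rewrite -subr_eq0.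
    by rewrite mulfK ?eqxx // sqrf_eq0.
  move=> E; have [|-> ->] := @lin_a_eq0 c0 c1; last by rewrite c2E c3E.
  by move: E; rewrite c2E c3E !inA !rmorph0 !mul0r !addr0.
rewrite !inA => E.
set N := _ - _ in c20.
(* Solving for b: multiply the relation by the conjugate of c2 + c3 a. *)
pose s := - (c0 * c2 - c1 * c3 * m%:R) / N; pose t := - (c1 * c2 - c0 * c3) / N.
have NK : in_alg K N != 0 by rewrite fmorph_eq0.
have bE : b = s%:A + t%:A * a.
  apply: (mulfI NK); rewrite !inA mulrDr mulrA -!rmorphM /s /t ![N * (_ / N)]mulrC !divfK //.
  rewrite /N !(rmorphB, rmorphN, rmorphM, rmorphXn) rmorph_nat -sqr_a.
  apply/eqP; rewrite -subr_eq0; apply/eqP.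
  transitivity ((in_alg K c2 - in_alg K c3 * a) *
    (in_alg K c0 + in_alg K c1 * a + in_alg K c2 * b + in_alg K c3 * (a * b))); first ring.
  by rewrite E mulr0.
clearbody s t.
have [] := @lin_a_eq0 (s ^+ 2 + t ^+ 2 * m%:R - n%:R) (2 * s * t).
  rewrite !inA !(rmorphB, rmorphD, rmorphM, rmorphXn, rmorph_nat) -sqr_a -sqr_b bE !inA; ring.
move=> H /eqP; rewrite !mulf_eq0 pnatr_eq0 /= => /orP[] /eqP z0.
  have := nonsquare_rat (t * m%:R) mn_nonsquare; case/eqP.
  by move/eqP: H; rewrite z0 expr0n add0r subr_eq0 natrM => /eqP <-; ring.
have := nonsquare_rat s n_nonsquare; case/eqP.
by move/eqP: H; rewrite z0 expr0n mul0r addr0 subr_eq0 => /eqP.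
Qed.

Lemma comb_inj : injective comb.
Proof.
move=> c d cd; pose mone : rat * rat * rat * rat := (-1, 0, 0, 0).
have : comb (comb_add c (comb_mul mone d)) = 0.
  rewrite combD combM cd /comb /= !inA !rmorph0 rmorphN1; ring.
move/comb_eq0; case: c {cd} => [[[c0 c1] c2] c3]; case: d => [[[d0 d1] d2] d3] /=.
case=> H0 H1 H2 H3; congr (_, _, _, _); lra.
Qed.

(** Changing the signs of the coordinates of a and a b respects products, because
    the multiplication rules only involve a^2 and b^2. *)
Lemma conj_exists : exists s : {rmorphism K -> K}, s a = - a /\ s b = b.
Proof.
have /choice[co coP] : forall x, exists c, x = comb c by exact: comb_surj.
have coK c : co (comb c) = c by apply: comb_inj; rewrite -coP.
pose tw (c : rat * rat * rat * rat) := let: (c0, c1, c2, c3) := c in (c0, - c1, c2, - c3).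
pose s x := comb (tw (co x)).
have sE c : s (comb c) = comb (tw c) by rewrite /s coK.
have twD c d : tw (comb_add c d) = comb_add (tw c) (tw d).
  case: c d => [[[c0 c1] c2] c3] [[[d0 d1] d2] d3] /=; congr (_, _, _, _); ring.
have twM c d : tw (comb_mul c d) = comb_mul (tw c) (tw d).
  case: c d => [[[c0 c1] c2] c3] [[[d0 d1] d2] d3] /=; congr (_, _, _, _); ring.
have oneE : 1 = comb (1, 0, 0, 0) by rewrite /comb !inA !rmorph0 rmorph1; ring.
have sM : monoid_morphism s.
  split; first by rewrite oneE sE /tw !oppr0.
  by move=> x y; rewrite (coP x) (coP y) -combM !sE twM combM.
have sB : zmod_morphism s.
  have NE x : - x = comb (-1, 0, 0, 0) * x.
    by rewrite /comb !inA !rmorph0 rmorphN1; ring.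
  move=> x y; rewrite (coP x) (coP y) !NE -combM -combD !sE twD twM combD combM.
  by rewrite /= !oppr0.
pose sr : {rmorphism K -> K} := HB.pack s (GRing.isZmodMorphism.Build _ _ s sB)
  (GRing.isMonoidMorphism.Build _ _ s sM).
exists sr; split; rewrite -[LHS]/(s _).
  have -> : a = comb (0, 1, 0, 0) by rewrite /comb !inA !rmorph0 rmorph1; ring.
  by rewrite sE /comb /= !inA ?oppr0 !rmorph0 rmorphN1 rmorph1; ring.
have -> : b = comb (0, 0, 1, 0) by rewrite /comb !inA !rmorph0 rmorph1; ring.
by rewrite sE /comb /= !inA ?oppr0 !rmorph0 rmorph1; ring.
Qed.

End Coordinates.

(** * Squares up to units, and traces *)

Section UnitTimesSquare.
Variable K : fieldExtType rat.
Local Notation OI := (integral_pred (K := K)).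

(** The unit [e] is constrained to be nonzero because the inverse of zero is
    zero. *)
Definition sqr_up_to_unit (d : nat) : Prop := exists g e : K,
  [/\ g ^+ 2 = d%:R * e, e != 0, e \in OI & e^-1 \in OI].

Lemma sqr_up_to_unitM d d' : sqr_up_to_unit d -> sqr_up_to_unit d' -> sqr_up_to_unit (d * d').
Proof.
move=> [g [e [gE e0 eI eV]]] [g' [e' [gE' e0' eI' eV']]]; exists (g * g'), (e * e').
split; [by rewrite exprMn gE gE' natrM; ring | exact: mulf_neq0 | exact: rpredM |].
by rewrite invfM; exact: rpredM.
Qed.

Lemma sqr_up_to_unit_sqr x d : (0 < x)%N -> sqr_up_to_unit (x ^ 2 * d) -> sqr_up_to_unit d.
Proof.
move=> x0 [g [e [gE e0 eI eV]]]; exists (g / x%:R), e; split=> //.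
have xK : x%:R != 0 :> K by rewrite natr_eq0 -lt0n.
by rewrite expr_div_n gE natrM natrX; field.
Qed.

(** (d x + y delta)^2 = d (d x^2 + e y^2 + 2 x y delta), and the second factor
    has norm (d x^2 - e y^2)^2 = 1. *)
Lemma sqr_up_to_unit_pell (delta : K) d e x y : delta ^+ 2 = (d * e)%:R ->
  (d * x ^ 2 = e * y ^ 2 + 1)%N -> sqr_up_to_unit d.
Proof.
move=> dE xyE; have dI : delta \in OI by apply: integral_sqr; rewrite dE rpred_nat.
have E : d%:R * x%:R ^+ 2 - e%:R * y%:R ^+ 2 = 1 :> K.
  by rewrite -!natrX -!natrM xyE natrD addrAC subrr add0r.
pose u : K := d%:R * x%:R ^+ 2 + e%:R * y%:R ^+ 2.
pose v : K := 2%:R * x%:R * y%:R * delta.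
have uI : u \in OI by rewrite rpredD // rpredM ?rpredX ?rpred_nat.
have vI : v \in OI by apply: rpredM => //; rewrite !rpredM ?rpred_nat.
have uvE : (u + v) * (u - v) = 1.
  rewrite mulrC -subr_sqr /v 3!exprMn dE natrM.
  transitivity ((d%:R * x%:R ^+ 2 - e%:R * y%:R ^+ 2) ^+ 2 : K); last by rewrite E expr1n.
  by rewrite /u; ring.
have uv0 : u + v != 0.
  by apply/eqP => uv0; move/eqP: uvE; rewrite uv0 mul0r eq_sym oner_eq0.
exists (d%:R * x%:R + y%:R * delta), (u + v); split=> //.
- rewrite sqrrD [(y%:R * delta) ^+ 2]exprMn dE natrM /u /v; ring.
- exact: rpredD.
have -> : (u + v)^-1 = u - v; last exact: rpredB.
by apply: (mulfI uv0); rewrite uvE divff.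
Qed.

End UnitTimesSquare.

Section Conjugation.
Variable K : fieldExtType rat.
Local Notation OI := (integral_pred (K := K)).

Lemma rmorph_ratA (s : {rmorphism K -> K}) (q : rat) : s q%:A = q%:A.
Proof.
have -> : q%:A = in_alg K q by [].
by rewrite -[LHS]/((s \o in_alg K) q) !fmorph_eq_rat.
Qed.

Lemma integral_pred_rmorph (s : {rmorphism K -> K}) x : x \in OI -> s x \in OI.
Proof.
move=> /asboolP[p mon_p rp]; apply/asboolP; exists p => //.
have -> : map_poly intr p = map_poly s (map_poly intr p) :> {poly K}.
  by rewrite -map_poly_comp; apply: eq_map_poly => z /=; rewrite rmorph_int.
by rewrite fmorph_root.
Qed.

(** With m = 4 k + 1, this is a root of X^2 - X - k. *)
Lemma integral_half (a : K) m : (m %% 4 = 1)%N -> a ^+ 2 = m%:R -> (1 + a) / 2%:R \in OI.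
Proof.
move=> m4 aE; have mE := divn_eq m 4; rewrite m4 in mE.
set x := _ / _; set k := (m %/ 4)%N in mE.
have two0 : 2%:R != 0 :> K by rewrite natr_eq0.
have xE : x ^+ 2 = x + k%:R.
  rewrite /x expr_div_n sqrrD aE mE natrD natrM expr1n; field. by rewrite two0 (natr_eq0 K 4).
apply/asboolP; apply: (@integral_root_monic _ K _ x ('X^2 - ('X + k%:R%:P))).
- rewrite monicE lead_coefDl ?lead_coefXn // size_polyXn size_opp.
  by rewrite size_XaddC.
- by rewrite /root !hornerE xE subrr.
apply/integral_poly => i; rewrite coefB coefXn coefD coefX coefC.
apply: integral_sub; first exact: integral_nat.
apply: integral_add; first exact: integral_nat.
by case: eqP => _; [exact: integral_nat | exact: integral0].
Qed.

Variables (m n : nat) (a b : K).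
Hypotheses (sqr_a : a ^+ 2 = m%:R) (sqr_b : b ^+ 2 = n%:R).
Hypothesis span_ab : <<1 & [:: a; b]>>%VS = {:K}%VS.
Hypothesis m_nonsquare : forall x : nat, (x ^ 2)%N != m.
Hypothesis n_nonsquare : forall x : nat, (x ^ 2)%N != n.
Hypothesis mn_nonsquare : forall x : nat, (x ^ 2)%N != (m * n)%N.
Hypotheses (m_mod4 : (m %% 4 = 1)%N) (n_mod4 : (n %% 4 = 1)%N).

Variables sa sb : {rmorphism K -> K}.
Hypotheses (sa_a : sa a = - a) (sa_b : sa b = b) (sb_a : sb a = a) (sb_b : sb b = - b).

Lemma conj_comb (c0 c1 c2 c3 : rat) :
  sa (comb a b (c0, c1, c2, c3)) = comb a b (c0, - c1, c2, - c3) /\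
  sb (comb a b (c0, c1, c2, c3)) = comb a b (c0, c1, - c2, - c3).
Proof.
rewrite /comb !rmorphD !rmorphM !rmorph_ratA sa_a sa_b sb_a sb_b.
by split; rewrite !scaleNr; ring.
Qed.

Let surj := comb_surj sqr_a sqr_b span_ab.

Lemma conjK : involutive sa /\ involutive sb.
Proof.
split=> x; have [[[[c0 c1] c2] c3] ->] := surj x.
  by rewrite !(conj_comb _ _ _ _).1 !opprK.
by rewrite !(conj_comb _ _ _ _).2 !opprK.
Qed.

Lemma conjC x : sa (sb x) = sb (sa x).
Proof.
have [[[[c0 c1] c2] c3] ->] := surj x.
by rewrite !((conj_comb _ _ _ _).1, (conj_comb _ _ _ _).2).
Qed.

Lemma conj_fixed x : sa x = x -> sb x = x -> exists q : rat, x = q%:A.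
Proof.
have [[[[c0 c1] c2] c3] ->] := surj x.
rewrite (conj_comb _ _ _ _).1 (conj_comb _ _ _ _).2.
have inj := comb_inj sqr_a sqr_b m_nonsquare n_nonsquare mn_nonsquare.
move=> /inj[h1 h3] /inj[h2 _]; exists c0.
have [-> -> ->] : [/\ c1 = 0, c2 = 0 & c3 = 0] by split; lra.
by rewrite /comb !scale0r !mul0r !addr0.
Qed.

Definition trace x := x + sa x + sb x + sa (sb x).

Lemma trace_int x : x \in OI -> exists z : int, trace x = z%:~R.
Proof.
move=> xI; have [saK sbK] := conjK.
have [||q qE] := @conj_fixed (trace x).
- by rewrite /trace !rmorphD /= !saK; ring.
- by rewrite /trace !rmorphD /= -!conjC !sbK; ring.
by apply: (integral_intr qE); rewrite /trace !rpredD ?integral_pred_rmorph.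
Qed.

Let alpha := (1 + a) / 2%:R.
Let beta := (1 + b) / 2%:R.

(** The product of the two relative identities x b = T(x) (b - 1) / 2 + T(x beta),
    where T is the trace over Q(a), and its analogue for a.  It controls
    an integral element through the traces of its integral multiples. *)
Lemma trace_recover x : x * (a * b) =
  trace x * ((alpha - 1) * (beta - 1)) + trace (x * alpha) * (beta - 1)
  + trace (x * beta) * (alpha - 1) + trace (x * (alpha * beta)).
Proof.
have two0 : 2%:R != 0 :> K by rewrite natr_eq0.
rewrite /trace /alpha /beta !(rmorphM, rmorphD, fmorphV, rmorph1, rmorph_nat) /=.
rewrite !sa_a !sb_b !sb_a !rmorphN !sa_a !sa_b; field; exact: two0.
Qed.

Lemma trace_div_integral p x : (forall e, e \in OI -> trace (x * e) / p%:R \in OI) ->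
  x * (a * b) / p%:R \in OI.
Proof.
have aI : alpha \in OI by exact: integral_half sqr_a.
have bI : beta \in OI by exact: integral_half sqr_b.
move=> H; rewrite trace_recover.
have aI1 : alpha - 1 \in OI by rewrite rpredB ?rpred1.
have bI1 : beta - 1 \in OI by rewrite rpredB ?rpred1.
have T1 : trace x / p%:R \in OI by rewrite -[x]mulr1 H ?rpred1.
have Ta := H _ aI; have Tb := H _ bI; have Tab := H _ (rpredM aI bI).
rewrite [X in X \in _]mulrDl [X in X + _ \in _]mulrDl [X in X + _ + _ \in _]mulrDl.
apply: rpredD => //; apply: rpredD; first apply: rpredD.
- by rewrite mulrAC; apply: rpredM => //; exact: rpredM.
- by rewrite mulrAC; exact: rpredM.
by rewrite mulrAC; exact: rpredM.
Qed.

End Conjugation.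

(** * Maximal ideals, their products and their norms *)

Section IdealTheory.
Local Open Scope quotient_scope.
Variable R : idomainType.
Implicit Types I J m : ideal R.

(** The ideal generated by [I] and [x]. *)
Definition ideal_adj_pred I (x : R) : {pred R} :=
  fun z => `[< exists2 y, y \in I & exists c, z = y + c * x >].

Lemma ideal_adj_axiom I x : ideal_axiom (ideal_adj_pred I x).
Proof.
split=> [|c z /asboolP[y yI [d ->]]]; last first.
  apply/asboolP; exists (c * y); first exact: idealMl.
  by exists (c * d); rewrite mulrDr mulrA.
split=> [|u v /asboolP[y yI [c ->]] /asboolP[z zI [d ->]]]; apply/asboolP.
  by exists 0; [exact: rpred0 | exists 0; rewrite mul0r addr0].
exists (y - z); first exact: rpredB.
by exists (c - d); rewrite mulrBl opprD addrACA.
Qed.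

Definition ideal_adj I x := Ideal (ideal_adj_axiom I x).

Lemma maximal_neq1 m : is_maximal m -> 1 \notin m.
Proof.
move=> [m1 _]; apply/negP => m1I; apply: m1; apply: eq_ideal => x.
by rewrite mem_ideal1 -[x]mulr1 idealMl.
Qed.

Lemma maximal_bezout m x : is_maximal m -> x \notin m ->
  exists2 y, y \in m & exists c, 1 = y + c * x.
Proof.
move=> [m1 maxm] xm; have [z zm||E] := maxm (ideal_adj m x).
- by apply/asboolP; exists z => //; exists 0; rewrite mul0r addr0.
- move=> E; case/negP: xm; rewrite -E; apply/asboolP.
  by exists 0; [exact: rpred0 | exists 1; rewrite mul1r add0r].
have : 1 \in ideal_adj m x by rewrite E mem_ideal1.
by move/asboolP.
Qed.

Lemma maximal_prime m x y : is_maximal m -> x * y \in m -> x \in m \/ y \in m.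
Proof.
move=> maxm xym; have [|xm] := boolP (x \in m); [by left | right].
have [z zm [c E]] := maximal_bezout maxm xm.
rewrite -[y]mul1r E mulrDl -mulrA.
exact: rpredD (Defs.idealMr y zm) (idealMl c xym).
Qed.

Lemma maximal_prime_exp m x k : is_maximal m -> x ^+ k \in m -> x \in m.
Proof.
move=> maxm; elim: k => [|k IH].
  by rewrite expr0 => m1; have := maximal_neq1 maxm; rewrite m1.
by rewrite exprS => /(maximal_prime maxm)[|/IH].
Qed.

(** The product of distinct maximal ideals is their intersection, since each of
    them is comaximal with the product of the others. *)
Lemma mem_prod_maximal (s : seq (ideal R)) x : uniq s ->
  (forall m, m \in s -> is_maximal m) ->
  (x \in \big[@ideal_mul R/@ideal1 R]_(m <- s) m) <-> (forall m, m \in s -> x \in m).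
Proof.
elim: s x => [|m s IH] x /=; first by rewrite big_nil mem_ideal1.
move=> /andP[ms us] maxs.
have maxm : is_maximal m by apply: maxs; rewrite inE eqxx.
have {}maxs m' : m' \in s -> is_maximal m'.
  by move=> m's; apply: maxs; rewrite inE m's orbT.
rewrite big_cons; set P := \big[_/_]_(_ <- s) _.
(* The product of the other ideals is not contained in m, as m is prime. *)
have [u uP um] : exists2 u, u \in P & u \notin m.
  rewrite {}/P {IH}; elim: s ms us maxs => [|m' s IH] ms us maxs.
    by exists 1; [rewrite big_nil mem_ideal1 | exact: maximal_neq1].
  move: ms us; rewrite inE negb_or => /andP[mm' ms] /andP[m's us].
  have [|v vP vm] := IH ms us.
    by move=> m'' ?; apply: maxs; rewrite inE orbC => /=; apply/orP; left.
  have maxm' : is_maximal m' by apply: maxs; rewrite inE eqxx.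
  have [w wm' wm] : exists2 w, w \in m' & w \notin m.
    apply: contrapT => nw; case/eqP: mm'.
    have [z zm'|//|] := maxm'.2 m; last by move=> E; case: maxm.
    by apply: contrapT => /negP zm; apply: nw; exists z.
  exists (w * v); first by rewrite big_cons; exact: mem_ideal_mul.
  by apply/negP => /(maximal_prime maxm)[]; apply/negP.
split=> [xmP m'|H].
  have [xm xP] : x \in m /\ x \in P.
    by split; apply: sub_ideal_mul xmP => y z yI zI; [exact: Defs.idealMr | exact: idealMl].
  by rewrite inE => /predU1P[->//|m's]; apply: (IH x us maxs).1 xP _ m's.
have xP : x \in P by apply/IH => // m' m's; apply: H; rewrite inE m's orbT.
have xm : x \in m by apply: H; rewrite inE eqxx.
have [y ym [c E]] := maximal_bezout maxm um.
rewrite -[x]mulr1 E mulrDr; apply: rpredD.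
  by rewrite mulrC; exact: mem_ideal_mul.
by apply: mem_ideal_mul => //; exact: idealMl.
Qed.

(** Lagrange's theorem in the finite additive group R / I: translating by the
    class of 1 permutes the quotient, so the sum of its elements is unchanged by
    adding as many copies of that class as there are elements. *)
Lemma norm_mem I : (0 < ideal_norm I)%N -> (ideal_norm I)%:R \in I.
Proof.
rewrite /ideal_norm; set Q := ({ideal_quot _}) => Q0.
have finQ : finite_set [set: Q].
  apply: contrapT => infQ; move: Q0; rewrite /fset_set.
  by case: pselect => //; rewrite cardfs0.
pose s : seq Q := fset_set [set: Q].
have us : uniq s by exact: fset_uniq.
have sT x : x \in s by rewrite /s in_fset_set // inE.
have E : \sum_(x <- s) x = \sum_(x <- s) (x + \pi_Q 1).
  rewrite -(big_map (fun x => x + \pi_Q 1) xpredT id) /=.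
  apply: perm_big; apply: uniq_perm => //.
    by rewrite map_inj_uniq //; exact: addIr.
  move=> x; rewrite sT; apply/esym/mapP; exists (x - \pi_Q 1); first exact: sT.
  by rewrite subrK.
have : \sum_(x <- s) \pi_Q 1 = 0.
  by apply: (@addrI _ (\sum_(x <- s) x)); rewrite addr0 {2}E big_split.
rewrite big_const_seq count_predT iter_addr_0 -raddfMn /= => /eqP.
rewrite -[X in _ == X](raddf0 \pi_Q) /= => H.
by rewrite -[_%:R]subr0 Quotient.idealrBE.
Qed.

End IdealTheory.

Section Preimage.
Local Open Scope quotient_scope.
Variables (R : idomainType) (s : {rmorphism R -> R}).
Hypothesis sK : involutive s.

Definition ideal_preim_pred (I : ideal R) : {pred R} := fun x => s x \in I.

Lemma ideal_preim_axiom I : ideal_axiom (ideal_preim_pred I).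
Proof.
split=> [|c x xI]; last first.
  by rewrite -[_ \in _]/(s _ \in I) rmorphM; exact: Defs.idealMl.
split=> [|x y xI yI]; rewrite -[_ \in _]/(s _ \in I).
  by rewrite rmorph0 rpred0.
by rewrite rmorphB; exact: rpredB.
Qed.

Definition ideal_preim I := Ideal (ideal_preim_axiom I).

Lemma mem_ideal_preim I x : (x \in ideal_preim I) = (s x \in I).
Proof. by []. Qed.

Lemma ideal_preimK : involutive ideal_preim.
Proof. by move=> I; apply: eq_ideal => x; rewrite !mem_ideal_preim sK. Qed.

Lemma ideal_preim1 : ideal_preim (ideal1 R) = ideal1 R.
Proof. by apply: eq_ideal => x; rewrite mem_ideal_preim !mem_ideal1. Qed.

Lemma ideal_preim_maximal I : is_maximal I -> is_maximal (ideal_preim I).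
Proof.
move=> [I1 maxI]; split=> [E|J sub].
  by apply: I1; rewrite -[I]ideal_preimK E ideal_preim1.
have [x xI|E|E] := maxI (ideal_preim J).
- by rewrite mem_ideal_preim; apply: sub; rewrite mem_ideal_preim sK.
- by left; rewrite -E ideal_preimK.
by right; rewrite -[J]ideal_preimK E ideal_preim1.
Qed.

(** The ring automorphism induces a bijection between the quotients.  Positivity
    of the norm says that the quotient is finite. *)
Lemma ideal_preim_norm I : (0 < ideal_norm I)%N -> ideal_norm (ideal_preim I) = ideal_norm I.
Proof.
rewrite /ideal_norm; set Q := ({ideal_quot ideal_mem I}); set Q' := ({ideal_quot _}) => Q0.
have finQ : finite_set [set: Q].
  apply: contrapT => infQ; move: Q0; rewrite /fset_set.
  by case: pselect => //; rewrite cardfs0.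
pose f (x : Q) : Q' := \pi_Q' (s (repr x)).
have fE x : f (\pi_Q x) = \pi_Q' (s x).
  apply/eqP; rewrite -Quotient.idealrBE -rmorphB.
  by rewrite -[_ \in _]/(s (s _) \in I) sK Quotient.idealrBE reprK.
have finj : injective f.
  move=> x y; rewrite -[x]reprK -[y]reprK !fE => /eqP.
  rewrite -Quotient.idealrBE -rmorphB -[_ \in _]/(s (s _) \in I) sK.
  by rewrite Quotient.idealrBE => /eqP.
have -> : [set: Q']%classic = [set f x | x in [set: Q]]%classic.
  apply/seteqP; split=> // y _; exists (\pi_Q (s (repr y))) => //.
  by rewrite fE sK reprK.
by rewrite fset_set_image // card_imfset.
Qed.

End Preimage.

(** * Ideals above the divisors of a radicand *)

Section ColonIdeal.
Variable K : fieldExtType rat.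
Local Notation OK := (ring_of_integers K).
Local Notation OI := (integral_pred (K := K)).
Local Notation v := (val : OK -> K).

(** With c = b / d, where b^2 = d r and d, r are coprime, this is the ideal (d, b),
    whose square is (d); with c = 1 / d it would be (d) itself. *)
Definition colon_pred (c : K) : {pred OK} := fun x => v x * c \in OI.

Lemma colon_axiom c : ideal_axiom (colon_pred c).
Proof.
split=> [|y x xc]; last first.
  rewrite -[_ \in _]/(v (y * x) * c \in OI) rmorphM -mulrA.
  by apply: rpredM; [exact: valP | exact: xc].
split=> [|x y xc yc]; first by rewrite -[_ \in _]/(v 0 * c \in OI) rmorph0 mul0r rpred0.
by rewrite -[_ \in _]/(v (x - y) * c \in OI) rmorphB mulrBl; exact: rpredB.
Qed.

Definition colon_ideal c := Ideal (colon_axiom c).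

Lemma mem_colon c x : (x \in colon_ideal c) = (v x * c \in OI).
Proof. by []. Qed.

Lemma val_integral (x : OK) : v x \in OI. Proof. exact: valP. Qed.

Lemma mem_principal_div (g x : OK) : g != 0 ->
  (x \in ideal_principal g) = (v x / v g \in OI).
Proof.
move=> g0; have vg0 : v g != 0 by rewrite -(rmorph0 v) (inj_eq val_inj).
apply/mem_ideal_principal/idP => [[y ->]|xgI].
  by rewrite rmorphM mulfK // val_integral.
by exists (RingOfIntegers xgI); apply: val_inj; rewrite rmorphM /= divfK.
Qed.

Lemma natO_neq0 d : (0 < d)%N -> d%:R != 0 :> OK.
Proof. by move=> d0; rewrite -(inj_eq val_inj) rmorph_nat rmorph0 natr_eq0 -lt0n. Qed.

Section RamifiedDivisor.
Variables (b : K) (d r : nat).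
Hypotheses (d_gt0 : (0 < d)%N) (cop_dr : coprime d r) (b_sqr : b ^+ 2 = (d * r)%:R).

Let dK : d%:R != 0 :> K. Proof. by rewrite natr_eq0 -lt0n. Qed.

Lemma b_integral : b \in OI.
Proof. by apply: integral_sqr; rewrite b_sqr rpred_nat. Qed.

Lemma sqr_b_div : (b / d%:R) ^+ 2 = r%:R / d%:R.
Proof. by rewrite expr_div_n b_sqr natrM; field. Qed.

(** Let g^2 = d e with e a unit, and y = x / g.  Both d y^2 and r y^2 differ from
    the squares of x and x b / d by units, so if these are integral then y^2 is,
    by coprimality of d and r, and y with it. *)
Lemma colon_principal : sqr_up_to_unit K d ->
  exists2 g : OK, g != 0 & colon_ideal (b / d%:R) = ideal_principal g.
Proof.
move=> [g [e [gE e0 eI eV]]].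
have gI : g \in OI by apply: integral_sqr; rewrite gE rpredM ?rpred_nat.
have g0 : g != 0 by rewrite -sqrf_eq0 gE mulf_neq0.
pose gO := RingOfIntegers gI; have gO0 : gO != 0.
  by rewrite -(inj_eq val_inj) rmorph0.
exists gO => //; apply: eq_ideal => x; rewrite mem_principal_div // mem_colon /=.
have xI := val_integral x.
apply/idP/idP => H; apply: integral_sqr.
  have E1 : r%:R * (v x / g) ^+ 2 = (v x * (b / d%:R)) ^+ 2 * e^-1.
    by rewrite [(v x / g) ^+ 2]expr_div_n gE exprMn sqr_b_div; field; rewrite dK e0.
  have E2 : d%:R * (v x / g) ^+ 2 = v x ^+ 2 * e^-1.
    by rewrite expr_div_n gE; field; rewrite dK e0.
  apply: (integral_coprime_div cop_dr); rewrite ?E1 ?E2; apply: rpredM => //;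
    exact: rpredX.
have -> : (v x * (b / d%:R)) ^+ 2 = (v x / g) ^+ 2 * (r%:R * e).
  by rewrite [(v x / g) ^+ 2]expr_div_n gE exprMn sqr_b_div; field; rewrite dK e0.
by rewrite rpredM ?rpredX // rpredM ?rpred_nat.
Qed.

Definition sqrtO : OK := RingOfIntegers b_integral.

Lemma ideal_coprime (I : ideal OK) (u w : nat) (x : OK) : coprime u w ->
  u%:R * x \in I -> w%:R * x \in I -> x \in I.
Proof.
move=> /(coprime_combination x)[k [l xE]] ux wx; rewrite xE.
by apply: rpredD; exact: Defs.idealMl.
Qed.

Lemma nat_mem_colon : d%:R \in colon_ideal (b / d%:R).
Proof. by rewrite mem_colon rmorph_nat mulrC divfK // b_integral. Qed.

Lemma sqrt_mem_colon : sqrtO \in colon_ideal (b / d%:R).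
Proof.
rewrite mem_colon /= mulrA -expr2 b_sqr natrM mulrAC divff // mul1r; exact: rpred_nat.
Qed.

(** One inclusion holds because d^2 and b^2 = d r lie in the square of (d, b)
    and have greatest common divisor d. *)
Lemma colon_sqr : ideal_mul (colon_ideal (b / d%:R)) (colon_ideal (b / d%:R)) =
  ideal_principal d%:R.
Proof.
apply: eq_ideal => z; apply/idP/idP; last first.
  move=> /mem_ideal_principal[y ->]; apply: Defs.idealMl.
  apply: (ideal_coprime cop_dr); first by apply: mem_ideal_mul; exact: nat_mem_colon.
  have -> : r%:R * d%:R = sqrtO * sqrtO.
    by apply: val_inj; rewrite !rmorphM !rmorph_nat /= -expr2 b_sqr natrM mulrC.
  by apply: mem_ideal_mul; exact: sqrt_mem_colon.
move: z; apply: sub_ideal_mul => x y; rewrite !mem_colon => xI yI.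
rewrite mem_principal_div ?natO_neq0 // rmorphM rmorph_nat.
apply: (integral_coprime_div cop_dr).
  by rewrite mulrC divfK //; apply: rpredM; exact: val_integral.
suff -> : r%:R * (v x * v y / d%:R) = (v x * (b / d%:R)) * (v y * (b / d%:R)) by exact: rpredM.
by rewrite mulrACA -expr2 sqr_b_div; field.
Qed.

End RamifiedDivisor.

(** The statement is (d, b) (e, b) = (d e, b): the product contains d e, d b and
    e b, hence b. *)
Lemma colon_mul (b : K) (d e r : nat) : (0 < d)%N -> (0 < e)%N -> coprime d e ->
  coprime (d * e) r -> b ^+ 2 = (d * e * r)%:R ->
  ideal_mul (colon_ideal (b / d%:R)) (colon_ideal (b / e%:R)) =
    colon_ideal (b / (d * e)%:R).
Proof.
move=> d0 e0 cop_de cop_r bE.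
have dK : d%:R != 0 :> K by rewrite natr_eq0 -lt0n.
have eK : e%:R != 0 :> K by rewrite natr_eq0 -lt0n.
have bEd : b ^+ 2 = (d * (e * r))%:R by rewrite bE mulnA.
have bEe : b ^+ 2 = (e * (d * r))%:R by rewrite bE mulnA [(e * d)%N]mulnC.
apply: eq_ideal => z; apply/idP/idP.
  move: z; apply: sub_ideal_mul => x y; rewrite !mem_colon => xI yI.
  rewrite rmorphM natrM; apply: (integral_coprime_div cop_de).
    suff -> : d%:R * (v x * v y * (b / (d%:R * e%:R))) = v x * (v y * (b / e%:R)).
      by rewrite rpredM ?val_integral.
    by field; rewrite ?dK ?eK.
  suff -> : e%:R * (v x * v y * (b / (d%:R * e%:R))) = v y * (v x * (b / d%:R)).
    by rewrite rpredM ?val_integral.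
  by field; rewrite ?dK ?eK.
rewrite mem_colon => zI; pose w : OK := RingOfIntegers zI.
set P := ideal_mul _ _.
have bP : sqrtO bEd \in P.
  apply: (ideal_coprime cop_de); last first.
    rewrite mulrC; exact: mem_ideal_mul (sqrt_mem_colon d0 bEd) (nat_mem_colon e0 bEe).
  have -> : sqrtO bEd = sqrtO bEe by apply: val_inj.
  exact: mem_ideal_mul (nat_mem_colon d0 bEd) (sqrt_mem_colon e0 bEe).
apply: (ideal_coprime cop_r).
  rewrite natrM mulrC; apply: Defs.idealMl.
  exact: mem_ideal_mul (nat_mem_colon d0 bEd) (nat_mem_colon e0 bEe).
have -> : r%:R * z = w * sqrtO bEd; last exact: Defs.idealMl.
apply: val_inj; rewrite !rmorphM rmorph_nat.
change (r%:R * v z = v z * (b / (d * e)%:R) * b).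
have -> : v z * (b / (d * e)%:R) * b = v z * (b ^+ 2 / (d * e)%:R) by ring.
by rewrite bE !natrM; field; rewrite ?dK ?eK.
Qed.

End ColonIdeal.

(** * Ostrowski ideals as radicals *)

Section ConjugationOK.
Variable K : fieldExtType rat.
Local Notation OK := (ring_of_integers K).
Local Notation v := (val : OK -> K).
Variable s : {rmorphism K -> K}.

Definition conjOK (x : OK) : OK := RingOfIntegers (integral_pred_rmorph s (val_integral x)).

Lemma conjOK_zmod : zmod_morphism conjOK.
Proof. by move=> x y; apply: val_inj; rewrite /= !rmorphB. Qed.

Lemma conjOK_monoid : monoid_morphism conjOK.
Proof. by split=> [|x y]; apply: val_inj; rewrite /= ?rmorph1 ?rmorphM. Qed.

HB.instance Definition _ := GRing.isZmodMorphism.Build OK OK conjOK conjOK_zmod.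
HB.instance Definition _ := GRing.isMonoidMorphism.Build OK OK conjOK conjOK_monoid.

Lemma conjOK_involutive : involutive s -> involutive conjOK.
Proof. by move=> sK x; apply: val_inj; rewrite /= sK. Qed.

End ConjugationOK.

Section Ostrowski.
Variable K : fieldExtType rat.
Local Notation OK := (ring_of_integers K).
Local Notation OI := (integral_pred (K := K)).
Local Notation v := (val : OK -> K).

Lemma maximal_int (m : ideal OK) (p : nat) (z : int) : prime p -> is_maximal m ->
  p%:R \in m -> z%:~R \in m -> (p %| z)%Z.
Proof.
move=> p_pr maxm pm zm.
rewrite dvdzE /=; apply: contraT => npz.
have cop : coprime p `|z| by rewrite prime_coprime.
have /negP[] := maximal_neq1 maxm.
apply: (ideal_coprime cop); rewrite mulr1 //.
by case: (z) zm => [k|k] //; rewrite NegzE rmorphN rpredN.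
Qed.

(** What is retained of the radical of (p), that is, the intersection of the
    maximal ideals above p; it is enough to determine this ideal in a
    biquadratic field. *)
Record radical_like (p : nat) (I : ideal OK) : Prop := RadicalLike {
  radical_nat : p%:R \in I;
  radical_conj : forall s : {rmorphism K -> K}, involutive s ->
    forall x, x \in I -> conjOK s x \in I;
  radical_int : forall z : int, z%:~R \in I -> (p %| z)%Z;
  radical_sqr : forall x, x ^+ 2 \in I -> x \in I }.

(** The Ostrowski ideal is the unit ideal if there are no maximal ideals of norm
    p^f.  Otherwise it is the intersection of these ideals; each contains p^f,
    hence p, meets Z in (p), and the family is stable under conjugation because
    conjugation preserves norms. *)
Lemma ostrowski_radical p f : prime p -> (0 < f)%N ->
  ostrowski K p f = ideal1 OK \/ radical_like p (ostrowski K p f).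
Proof.
move=> p_pr f0; rewrite /ostrowski; set A := (X in finite_support _ X).
case: finite_supportP => [_|X XA noX _]; first by left; rewrite big_nil.
have AX m : A m -> m \in X.
  move=> Am; apply: contrapT => /negP mX; have := noX m Am mX.
  by case: Am => -[].
have Amax m : A m -> is_maximal m by case.
have Xmax m : m \in (X : seq _) -> is_maximal m by move=> /XA; exact: Amax.
have XP x : (x \in \big[@ideal_mul OK/@ideal1 OK]_(m <- X) m) <-> (forall m, A m -> x \in m).
  rewrite (mem_prod_maximal x (fset_uniq X) Xmax); split=> H m.
    by move=> /AX; exact: H.
  by move=> /XA; exact: H.
have [[m0 Am0]|noA] := pselect (exists m, A m); last first.
  left; case: (fset_0Vmem X) => [->|[m /XA Am]]; first by rewrite big_nil.
  by case: noA; exists m.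
right.
have pA m : A m -> p%:R \in m.
  move=> [maxm Nm]; apply: (@maximal_prime_exp _ _ _ f maxm).
  by rewrite -natrX -Nm norm_mem // Nm expn_gt0 prime_gt0.
split.
- by apply/XP.
- move=> s sK x /XP H; apply/XP => m Am.
  have sOK := conjOK_involutive sK.
  apply: (H (ideal_preim (conjOK s) m)); case: Am => maxm Nm.
  split; first exact: ideal_preim_maximal.
  by rewrite ideal_preim_norm // Nm expn_gt0 prime_gt0.
- by move=> z /XP/(_ m0 Am0); apply: maximal_int => //; [exact: Amax | exact: pA].
by move=> x /XP H; apply/XP => m Am; apply: (maximal_prime_exp (Amax m Am) (H m Am)).
Qed.

End Ostrowski.

(** * Ostrowski ideals of a biquadratic field *)

Section Biquadratic.
Variable K : fieldExtType rat.
Local Notation OK := (ring_of_integers K).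
Local Notation OI := (integral_pred (K := K)).
Local Notation v := (val : OK -> K).

Lemma span_swap (a b : K) : <<1 & [:: a; b]>>%VS = <<1 & [:: b; a]>>%VS.
Proof. by rewrite adjoin_cons adjoin_seq1 [RHS]adjoin_cons adjoin_seq1 adjoinC. Qed.

Record biquadratic (m n : nat) (a b : K) : Prop := BiquadraticData {
  bq_sqr_a : a ^+ 2 = m%:R;
  bq_sqr_b : b ^+ 2 = n%:R;
  bq_span : <<1 & [:: a; b]>>%VS = {:K}%VS;
  bq_m_nonsquare : forall x : nat, (x ^ 2)%N != m;
  bq_n_nonsquare : forall x : nat, (x ^ 2)%N != n;
  bq_mn_nonsquare : forall x : nat, (x ^ 2)%N != (m * n)%N;
  bq_m_mod4 : (m %% 4 = 1)%N;
  bq_n_mod4 : (n %% 4 = 1)%N }.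

Lemma biquadratic_swap m n a b : biquadratic m n a b -> biquadratic n m b a.
Proof.
by case=> *; split=> //; [rewrite span_swap | rewrite mulnC].
Qed.

(** Traces of elements of I are sums of conjugates, hence rational integers in I,
    hence divisible by p. *)
Lemma radical_mul m n a b p (I : ideal OK) x : biquadratic m n a b -> (0 < p)%N ->
  radical_like p I -> x \in I -> v x * (a * b) / p%:R \in OI.
Proof.
move=> bq p0 rad xI; case: (bq) => sqa sqb span nsm nsn nsmn m4 n4.
have [sa [saa sab]] := conj_exists sqa sqb span nsm nsn nsmn.
have bq' := biquadratic_swap bq; case: (bq') => _ _ span' _ _ nsmn' _ _.
have [sb [sbb sba]] := conj_exists sqb sqa span' nsn nsm nsmn'.
have [saK sbK] := conjK sqa sqb span saa sab sba sbb.
have pK : p%:R != 0 :> K by rewrite natr_eq0 -lt0n.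
apply: (trace_div_integral sqa sqb m4 n4 saa sab sba sbb) => e eI.
pose y := x * RingOfIntegers eI.
have yI : y \in I by exact: Defs.idealMr.
have [z zE] := trace_int sqa sqb span nsm nsn nsmn saa sab sba sbb (val_integral y).
have zI : z%:~R \in I.
  have -> : z%:~R = y + conjOK sa y + conjOK sb y + conjOK sa (conjOK sb y).
    by apply: val_inj; rewrite rmorph_int -zE.
  have H := radical_conj rad.
  by rewrite !rpredD //; [exact: H | exact: H | apply: (H _ saK); exact: H].
have /dvdzP[k kE] := radical_int rad zI.
have -> : v x * e = v y by rewrite rmorphM.
by rewrite zE kE rmorphM /= mulfK // rpred_int.
Qed.

(** If p divides x a b, it divides x (a b)^2 = m n x. *)
Lemma radical_unramified m n a b p (I : ideal OK) : biquadratic m n a b ->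
  prime p -> coprime p (m * n) -> radical_like p I -> I = ideal_principal p%:R.
Proof.
move=> bq p_pr cop rad; have p0 := prime_gt0 p_pr.
have pK : p%:R != 0 :> K by rewrite natr_eq0 -lt0n.
have [sqa sqb _ _ _ _ _ _] := bq.
apply: eq_ideal => x; apply/idP/idP => [xI|/mem_ideal_principal[y ->]]; last first.
  exact: Defs.idealMl (radical_nat rad).
rewrite mem_principal_div ?natO_neq0 // rmorph_nat.
apply: (integral_coprime_div cop); first by rewrite mulrC divfK // val_integral.
have -> : (m * n)%:R * (v x / p%:R) = (v x * (a * b) / p%:R) * (a * b).
  by rewrite natrM -sqa -sqb; ring.
have aI : a \in OI by apply: integral_sqr; rewrite sqa rpred_nat.
have bI : b \in OI by apply: integral_sqr; rewrite sqb rpred_nat.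
by apply: rpredM; [exact: radical_mul bq p0 rad xI | exact: rpredM].
Qed.

(** If p divides x a b, it divides m x b, hence x b.  Conversely, if x b = p y and
    n = p r, then r x^2 = p y^2 lies in I, and so does x. *)
Lemma radical_ramified m n a b p r (I : ideal OK) : biquadratic m n a b ->
  prime p -> n = (p * r)%N -> coprime p r -> coprime p m -> radical_like p I ->
  I = colon_ideal (b / p%:R).
Proof.
move=> bq p_pr nE cop_r cop_m rad; have p0 := prime_gt0 p_pr.
have pK : p%:R != 0 :> K by rewrite natr_eq0 -lt0n.
have [sqa sqb _ _ _ _ _ _] := bq.
have aI : a \in OI by apply: integral_sqr; rewrite sqa rpred_nat.
have bI : b \in OI by apply: integral_sqr; rewrite sqb rpred_nat.
apply: eq_ideal => x; rewrite mem_colon; apply/idP/idP => xI.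
  apply: (integral_coprime_div cop_m).
    have -> : p%:R * (v x * (b / p%:R)) = v x * b by field.
    by rewrite rpredM ?val_integral.
  have -> : m%:R * (v x * (b / p%:R)) = (v x * (a * b) / p%:R) * a.
    by rewrite -sqa; ring.
  by apply: rpredM => //; exact: radical_mul bq p0 rad xI.
pose y : OK := RingOfIntegers xI.
apply: (radical_sqr rad); apply: (ideal_coprime cop_r).
  by rewrite mulrC; apply: Defs.idealMl; exact: radical_nat rad.
have -> : r%:R * x ^+ 2 = y ^+ 2 * p%:R.
  apply: val_inj; rewrite !(rmorphM, rmorphXn) !rmorph_nat.
  change (r%:R * v x ^+ 2 = (v x * (b / p%:R)) ^+ 2 * p%:R).
  by rewrite exprMn expr_div_n sqb nE natrM; field.
by apply: Defs.idealMl; exact: radical_nat rad.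
Qed.

(** The prime p divides n exactly once and does not divide m. *)
Definition ramified_dvd (m n p : nat) := exists2 r, n = (p * r)%N & coprime p r && coprime p m.

Lemma ostrowski_ramified m n a b p f : biquadratic m n a b -> prime p -> (0 < f)%N ->
  ramified_dvd m n p -> ostrowski K p f = ideal1 OK \/ ostrowski K p f = colon_ideal (b / p%:R).
Proof.
move=> bq p_pr f0 [r nE /andP[cr cm]].
have [->|rad] := ostrowski_radical K p_pr f0; [by left | right].
exact: radical_ramified bq p_pr nE cr cm rad.
Qed.

Lemma principal1 : is_principal (ideal1 OK).
Proof. by exists 1. Qed.

Lemma ostrowski_principal m n a b p f : biquadratic m n a b -> prime p -> (0 < f)%N ->
  [\/ coprime p (m * n), ramified_dvd m n p /\ sqr_up_to_unit K p |
      ramified_dvd n m p /\ sqr_up_to_unit K p] ->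
  is_principal (ostrowski K p f).
Proof.
have ram m' n' a' b' : biquadratic m' n' a' b' -> prime p -> (0 < f)%N ->
    ramified_dvd m' n' p /\ sqr_up_to_unit K p -> is_principal (ostrowski K p f).
  move=> bq p_pr f0 [ramp good]; have [->|->] := ostrowski_ramified bq p_pr f0 ramp.
    exact: principal1.
  case: ramp => r nE /andP[cr _].
  have [g _ ->] := colon_principal (prime_gt0 p_pr) cr (etrans (bq_sqr_b bq) (congr1 _ nE)) good.
  by exists g.
move=> bq p_pr f0 [cop|H|H].
- have [->|rad] := ostrowski_radical K p_pr f0; first exact: principal1.
  by exists p%:R; exact: radical_unramified bq p_pr cop rad.
- exact: ram bq p_pr f0 H.
exact: ram (biquadratic_swap bq) p_pr f0 H.
Qed.

End Biquadratic.

(** * Ideal classes and the Polya group *)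

Section ClassGroup.
Local Open Scope quotient_scope.
Variable R : idomainType.

(** The elements of the product of [(c)] and [I] are the multiples of [c] by
    elements of [I], so [(c) I = (d)] makes [I] generated by [d / c]. *)
Lemma class_of_eq1 (I : nzideal R) : class_of I = ideal_class1 R <-> is_principal I.
Proof.
split=> [/eqmodP/asboolP[c [d [c0 d0 E]]]|[g gE]].
  have [z zI dE] : exists2 z, z \in (I : ideal R) & d = c * z.
    have : d \in ideal_mul (ideal_principal c) I.
      rewrite E ideal_mulC ideal_mul1l.
      by apply/mem_ideal_principal; exists 1; rewrite mul1r.
    move=> /asboolP[s sI ->].
    elim: s sI => [|u s IH] sI; first by exists 0; rewrite ?rpred0 ?big_nil ?mulr0.
    have [z zI zE] : exists2 z, z \in (I : ideal R) & \sum_(u <- s) u.1 * u.2 = c * z.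
      by apply: IH => w ws; apply: sI; rewrite inE ws orbT.
    have [/mem_ideal_principal[y yE] uI] : u.1 \in ideal_principal c /\ u.2 \in (I : ideal R).
      by apply: sI; rewrite inE eqxx.
    exists (y * u.2 + z); first by apply: rpredD => //; exact: Defs.idealMl.
    by rewrite big_cons zE yE mulrDr mulrCA mulrA.
  exists z; apply: eq_ideal => x; apply/idP/mem_ideal_principal => [xI|[y ->]]; last first.
    exact: Defs.idealMl.
  have : c * x \in ideal_mul (ideal_principal d) (nzideal1 R).
    rewrite -E; apply: mem_ideal_mul => //.
    by apply/mem_ideal_principal; exists 1; rewrite mul1r.
  rewrite ideal_mulC ideal_mul1l => /mem_ideal_principal[y].
  by rewrite dE mulrCA => /(mulfI c0) ->; exists y.
have g0 : g != 0.
  by apply/eqP => g0; apply: (@nzidealP _ I); rewrite gE g0.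
apply/eqmodP/asboolP; exists 1, g; split; rewrite ?oner_neq0 //.
by rewrite gE ideal_principalM mul1r ideal_mulC ideal_mul1l.
Qed.

End ClassGroup.

Section PolyaGroup.
Variable K : fieldExtType rat.
Local Notation OK := (ring_of_integers K).

(** If the product of any two non-principal Ostrowski ideals is principal, then
    their classes are all equal to one class c with c^2 = 1, and the Polya group
    is {1, c}. *)
Lemma polya_dichotomy :
  (forall p f p' f', prime p -> (0 < f)%N -> prime p' -> (0 < f')%N ->
     ~ is_principal (ostrowski K p f) -> ~ is_principal (ostrowski K p' f') ->
     is_principal (ideal_mul (ostrowski K p f) (ostrowski K p' f'))) ->
  polya_field K \/ polya_group_isog_Z2 K.
Proof.
move=> H; have [|npol] := pselect (polya_field K); [by left | right].
have [p [f [p_pr f0 nprin]]] : exists p f, [/\ prime p, (0 < f)%N & ~ is_principal (ostrowski K p f)].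
  apply: contrapT => no; apply: npol => p f p_pr f0.
  by apply: contrapT => nprin; apply: no; exists p, f.
have nz : ostrowski K p f <> ideal0 OK by move=> E; apply: nprin; exists 0.
pose I0 := NzIdeal nz; pose c := class_of I0.
have c1 : c <> 1%g by move/class_of_eq1.
have ccE (J : nzideal OK) p' f' : prime p' -> (0 < f')%N -> nzideal_val J = ostrowski K p' f' ->
    ~ is_principal J -> (class_of J * c = 1)%g.
  move=> p'_pr f'0 JE nJ; rewrite -[LHS]class_ofM; apply/class_of_eq1.
  by rewrite /= JE; apply: H => //; rewrite -JE.
have cc : (c * c = 1)%g by apply: (ccE I0 p f).
have gen x : @polya_group K x -> x = 1%g \/ x = c.
  move: x; apply: smallest_sub => [|x [J [p' [f' [p'_pr f'0 JE]]] <-]].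
    split=> [|x y [->|->] [->|->]|x y [->|->]]; first by left.
    - by left; rewrite mul1g.
    - by right; rewrite mul1g.
    - by right; rewrite mulg1.
    - by left.
    - by rewrite mul1g => ->; left.
    by move=> cy; right; rewrite -[y]mul1g -cc -mulgA cy mulg1.
  have [/class_of_eq1 ->|nJ] := pselect (is_principal J); [by left | right].
  by rewrite -[class_of J]mulg1 -cc mulgA (ccE J p' f') // mul1g.
have P1 : @polya_group K 1%g by move=> S [[]].
have Pc : @polya_group K c.
  by apply: sub_gen_smallest; exists I0 => //; exists p, f.
pose phi (x : ideal_class OK) : 'Z_2 := if x == 1%g then 0 else 1.
have phi1 : phi 1%g = 0 by rewrite /phi eqxx.
have phic : phi c = 1 by rewrite /phi; case: eqP.
exists phi; split; last first.
  move=> x y /gen[->|->] /gen[->|->]; rewrite ?mul1g ?mulg1 ?cc ?phi1 ?phic ?add0r ?addr0 //.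
  by apply: val_inj.
split=> //.
  move=> x y /set_mem/gen[->|->] /set_mem/gen[->|->]; rewrite ?phi1 ?phic //.
move=> z _; case: z => [[|[|k]] //= lt]; [exists 1%g | exists c] => //.
  by rewrite phi1; apply: val_inj.
by rewrite phic; apply: val_inj.
Qed.

End PolyaGroup.

(** * The fields Q(sqrt(q1 q2), sqrt(p1 p2 p3)) *)

Lemma coprime_prod_primes ps q : prime q -> all prime ps ->
  coprime q (\prod_(p <- ps) p)%N = (q \notin ps).
Proof.
by move=> q_pr prs; rewrite prime_coprime // (@dvdn_prod_primes ps q xpredT) // andbT.
Qed.

Lemma ramified_dvd_prod ps qs p : uniq (ps ++ qs) -> all prime (ps ++ qs) -> p \in ps ->
  ramified_dvd (\prod_(q <- qs) q)%N (\prod_(q <- ps) q)%N p.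
Proof.
rewrite cat_uniq all_cat => /and3P[ups /hasPn disj uqs] /andP[prs qrs] pps.
have p_pr := allP prs p pps.
exists (\prod_(q <- rem p ps) q)%N; first by rewrite (big_rem p).
rewrite !coprime_prod_primes //; last by apply/allP => q /mem_rem; exact: (allP prs).
rewrite mem_rem_uniq // !inE eqxx /=; apply: contraL pps => pqs; exact: disj.
Qed.

Lemma sqr_up_to_unit_of_sqr (K : fieldExtType rat) (delta : K) D : delta ^+ 2 = D%:R ->
  sqr_up_to_unit K D.
Proof.
by move=> E; exists delta, 1; rewrite mulr1 oner_neq0 invr1 rpred1.
Qed.

Section TwoRadicands.
Variables p1 p2 p3 q1 q2 : nat.
Hypotheses (p1_prime : prime p1) (p2_prime : prime p2) (p3_prime : prime p3)
  (q1_prime : prime q1) (q2_prime : prime q2)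
  (distinct : uniq [:: p1; p2; p3; q1; q2])
  (p1_mod4 : (p1 = 3 %[mod 4])%N) (p2_mod4 : (p2 = 3 %[mod 4])%N)
  (q1_mod4 : (q1 = 3 %[mod 4])%N) (q2_mod4 : (q2 = 3 %[mod 4])%N)
  (p3_mod4 : (p3 = 1 %[mod 4])%N).
Variables (K : fieldExtType rat) (a b : K).
Hypotheses (sqr_a : a ^+ 2 = (q1 * q2)%:R) (sqr_b : b ^+ 2 = (p1 * p2 * p3)%:R)
  (span_ab : <<1 & [:: a; b]>>%VS = {:K}%VS).
Local Notation good := (sqr_up_to_unit K).
Let ps := [:: p1; p2; p3].
Let qs := [:: q1; q2].
Let m := (q1 * q2)%N.
Let n := (p1 * p2 * p3)%N.

Let mE : (\prod_(q <- qs) q)%N = m. Proof. by rewrite !big_cons big_nil muln1. Qed.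
Let nE : (\prod_(q <- ps) q)%N = n. Proof. by rewrite !big_cons big_nil muln1 mulnA. Qed.
Let prs : all prime (ps ++ qs).
Proof. by rewrite /= p1_prime p2_prime p3_prime q1_prime q2_prime. Qed.
Let mnE : (\prod_(q <- ps ++ qs) q)%N = (m * n)%N.
Proof. by rewrite big_cat /= mE nE mulnC. Qed.

Lemma bq : biquadratic m n a b.
Proof.
have [uq pq] : uniq qs /\ all prime qs.
  by move: distinct prs; rewrite (cat_uniq ps qs) (all_cat _ ps qs) => /and3P[_ _ ->] /andP[_ ->].
have [up pp] : uniq ps /\ all prime ps.
  by move: distinct prs; rewrite (cat_uniq ps qs) (all_cat _ ps qs) => /and3P[-> _ _] /andP[-> _].
split=> //.
- by rewrite -mE; exact: prod_primes_nonsquare.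
- by rewrite -nE; exact: prod_primes_nonsquare.
- by rewrite -mnE; exact: prod_primes_nonsquare.
- by rewrite -modnMm q1_mod4 q2_mod4.
by rewrite -modnMm -[(p1 * p2 %% 4)%N]modnMm p1_mod4 p2_mod4 p3_mod4.
Qed.

Let good_m : good m. Proof. exact: sqr_up_to_unit_of_sqr sqr_a. Qed.
Let good_n : good n. Proof. exact: sqr_up_to_unit_of_sqr sqr_b. Qed.

Let good_pell d e x y : (d * e)%N \in [:: m; n; m * n]%N ->
  (d * x ^ 2 = e * y ^ 2 + 1)%N -> good d.
Proof.
rewrite !inE => /or3P[] /eqP E xy.
- by apply: (@sqr_up_to_unit_pell K a d e x y) => //; rewrite E.
- by apply: (@sqr_up_to_unit_pell K b d e x y) => //; rewrite E.
by apply: (@sqr_up_to_unit_pell K (a * b) d e x y) => //; rewrite E exprMn sqr_a sqr_b -natrM.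
Qed.

Let goodM := @sqr_up_to_unitM K.
Let good_sqr := @sqr_up_to_unit_sqr K.

Let ramified_n l : l \in ps -> ramified_dvd m n l.
Proof. by move=> lps; rewrite -mE -nE; apply: ramified_dvd_prod. Qed.

Lemma ostrowski_principal_or p f : prime p -> (0 < f)%N -> (p \in ps -> good p) ->
  is_principal (ostrowski K p f).
Proof.
move=> p_pr f0 H; apply: (ostrowski_principal bq p_pr f0).
have [pps|pps] := boolP (p \in ps).
  constructor 2; split; last exact: H.
  exact: ramified_n.
have [pqs|pqs] := boolP (p \in qs).
  constructor 3; split.
    rewrite -mE -nE; apply: ramified_dvd_prod => //.
      by rewrite uniq_catC.
    by rewrite all_cat andbC -all_cat.
  have [gq1 gq2] : good q1 /\ good q2.
    by apply: (@good_q good goodM good_sqr p1 p2 p3 q1 q2).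
  by move: pqs; rewrite !inE => /orP[] /eqP->.
by constructor 1; rewrite -mnE coprime_prod_primes // mem_cat negb_or pps.
Qed.

Lemma polya_of_good : [/\ good p1, good p2 & good p3] -> polya_field K.
Proof.
move=> [g1 g2 g3] p f p_pr f0; apply: ostrowski_principal_or => //.
by rewrite !inE => /or3P[] /eqP->.
Qed.

Lemma polya_case : nonres_case p1 p2 p3 q1 q2 -> polya_field K.
Proof.
move=> H; apply: polya_of_good.
exact: (@good_p_all good goodM good_sqr p1 p2 p3 q1 q2).
Qed.

(** A non-principal Ostrowski ideal lies above some p_i.  If two of them lie above
    the same prime p, their product is (p).  If they lie above distinct primes p
    and p', the third prime is a square up to a unit, hence so is p p', and their
    product is principal. *)
Lemma polya_or_Z2 : polya_field K \/ polya_group_isog_Z2 K.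
Proof.
apply: polya_dichotomy => p f p' f' p_pr f0 p'_pr f'0 np np'.
have ram l g : prime l -> (0 < g)%N -> ~ is_principal (ostrowski K l g) ->
    [/\ l \in ps, ~ good l & ostrowski K l g = colon_ideal (b / l%:R)].
  move=> l_pr g0 nl.
  have lps : l \in ps.
    by apply: contraT => lps; case: nl; apply: ostrowski_principal_or => //; move/negbTE: lps => ->.
  have [E|E] := ostrowski_ramified bq l_pr g0 (ramified_n lps).
    by case: nl; rewrite E; exact: principal1.
  by split=> // gl; apply: nl; exact: ostrowski_principal_or.
have [pps ngp ->] := ram _ _ p_pr f0 np.
have [p'ps ngp' ->] := ram _ _ p'_pr f'0 np'.
have p0 := prime_gt0 p_pr; have p'0 := prime_gt0 p'_pr.
have [pp'|pp'] := eqVneq p p'.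
  rewrite -pp'; have [r nr /andP[cr _]] := ramified_n pps.
  exists p%:R; apply: (colon_sqr p0 cr); by rewrite sqr_b -nr.
have ups : uniq ps by move: distinct; rewrite (cat_uniq ps qs) => /and3P[].
have pps_all : all prime ps by move: prs; rewrite all_cat => /andP[].
have p'rem : p' \in rem p ps by rewrite mem_rem_uniq // inE eq_sym pp'.
pose r := (\prod_(q <- rem p' (rem p ps)) q)%N.
have nr : n = (p * p' * r)%N by rewrite -nE (big_rem p) //= (big_rem p') //= mulnA.
have rem_pr : all prime (rem p' (rem p ps)).
  by apply/allP => q /mem_rem/mem_rem; exact: (allP pps_all).
have cop : coprime p p' by rewrite prime_coprime // dvdn_prime2.
have copr : coprime (p * p') r.
  rewrite coprimeMl !coprime_prod_primes //.
  by apply/andP; split; apply/negP; [move=> /mem_rem|]; rewrite mem_rem_uniqF ?rem_uniq.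
have gpp' : good (p * p').
  have [j jps gj] : exists2 j, j \in ps & good j.
    have [gj|gj|gj] : [\/ good p1, good p2 | good p3].
      by apply: (@good_p_one good goodM good_sqr p1 p2 p3 q1 q2).
    - by exists p1; rewrite ?inE ?eqxx.
    - by exists p2; rewrite ?inE ?eqxx ?orbT.
    - by exists p3; rewrite ?inE ?eqxx ?orbT.
  have jr : r = j.
    (* p and p' are removed from the three primes, so only j is left. *)
    have jrem : j \in rem p' (rem p ps).
      rewrite mem_rem_uniq ?rem_uniq // inE mem_rem_uniq // inE jps andbT.
      by apply/andP; split; apply/eqP => E; [apply: ngp' | apply: ngp]; rewrite -E.
    have : size (rem p' (rem p ps)) = 1%N by rewrite !size_rem.
    rewrite /r; case: (rem p' _) jrem => [|x [|? ?]] //= xj _.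
    by rewrite big_seq1; move: xj; rewrite inE => /eqP.
  apply: (good_div goodM good_sqr (prime_gt0 (allP pps_all j jps)) gj).
  by rewrite mulnC -jr -nr.
have pp'0 : (0 < p * p')%N by rewrite muln_gt0 p0.
have [g _ E] := colon_principal pp'0 copr (etrans sqr_b (congr1 _ nr)) gpp'.
exists g; rewrite -E; apply: (colon_mul p0 p'0 cop copr); by rewrite sqr_b -nr.
Qed.

End TwoRadicands.

Lemma legendre_natM a b p : prime p -> odd p -> ~~ (p %| a)%N -> ~~ (p %| b)%N ->
  legendre (a * b)%N p = (-1) ^+ (nonres a p (+) nonres b p).
Proof.
move=> p_pr p_odd pa pb.
by rewrite PoszM legendreM // !legendre_nonres // signr_addb.
Qed.

Theorem theorem1p1 (p1 p2 p3 q1 q2 : nat) (K : fieldExtType rat)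
  (p1_prime : prime p1) (p2_prime : prime p2) (p3_prime : prime p3)
  (q1_prime : prime q1) (q2_prime : prime q2)
  (distinct : uniq [:: p1; p2; p3; q1; q2])
  (p1_mod4 : (p1 = 3 %[mod 4])%N) (p2_mod4 : (p2 = 3 %[mod 4])%N)
  (q1_mod4 : (q1 = 3 %[mod 4])%N) (q2_mod4 : (q2 = 3 %[mod 4])%N)
  (p3_mod4 : (p3 = 1 %[mod 4])%N)
  (qq_mod8 : (q1 * q2 = 1 %[mod 8])%N)
  (ppp_mod8 : (p1 * p2 * p3 = 1 %[mod 8])%N)
  (K_def : generated_by_sqrts K (q1 * q2)%N (p1 * p2 * p3)%N) :
  (* 1 *)
  ([/\ legendre p1 p2 = 1, legendre p1 p3 = 1 & legendre p2 p3 = -1] ->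
   [/\ legendre p3 q1 = -1, legendre p3 q2 = -1,
       legendre p1 q1 = -1 & legendre p1 q2 = -1] ->
   legendre (q1 * q2)%N p2 = -1 ->
   polya_field K) /\
  (* 2 *)
  ([/\ legendre p1 p2 = 1, legendre p1 p3 = -1 & legendre p2 p3 = 1] ->
   [/\ legendre p3 q1 = -1, legendre p3 q2 = -1,
       - legendre p1 q1 = -1 & - legendre p1 q2 = -1] ->
   legendre (q1 * q2)%N p2 = -1 ->
   polya_field K) /\
  (* 3 *)
  (legendre p1 p3 = -1 /\ legendre p2 p3 = -1 ->
   legendre p3 q1 = 1 /\ - legendre p3 q2 = 1 ->
   [/\ legendre (p1 * p2)%N q1 = -1, legendre (p1 * p2)%N q2 = -1
     & - legendre (q1 * q2)%N p1 = -1] ->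
   polya_field K) /\
  (* 4 *)
  ([/\ legendre p1 p2 = -1, legendre p1 p3 = 1 & legendre p2 p3 = -1] ->
   legendre p3 q1 = -1 /\ legendre p3 q2 = -1 ->
   [/\ legendre (p1 * p2)%N q1 = 1, legendre (p1 * p2)%N q2 = 1
     & - legendre (q1 * q2)%N p1 = 1] ->
   polya_field K) /\
  (* 5 *)
  ([/\ legendre p1 p2 = -1, legendre p1 p3 = -1 & legendre p2 p3 = 1] ->
   [/\ legendre p3 q1 = -1, legendre p3 q2 = -1,
       legendre p1 q1 = -1 & legendre p1 q2 = -1] ->
   legendre (q1 * q2)%N p2 = -1 ->
   polya_field K) /\
  (legendre p1 p3 = 1 /\ legendre p2 p3 = 1 ->
   polya_field K \/ polya_group_isog_Z2 K).
Proof.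
have [a [b [sqr_a sqr_b span_ab]]] := K_def.
have Z2 : polya_field K \/ polya_group_isog_Z2 K.
  exact: (polya_or_Z2 p1_prime p2_prime p3_prime q1_prime q2_prime
    distinct p1_mod4 p2_mod4 q1_mod4 q2_mod4 p3_mod4 sqr_a sqr_b span_ab).
have case_polya : nonres_case p1 p2 p3 q1 q2 -> polya_field K.
  exact: (polya_case p1_prime p2_prime p3_prime q1_prime q2_prime
    distinct p1_mod4 p2_mod4 q1_mod4 q2_mod4 p3_mod4 sqr_a sqr_b span_ab).
have odd3 p : (p = 3 %[mod 4])%N -> odd p.
  by move=> pr; rewrite (divn_eq p 4) pr oddD oddM andbF.
have [[[o1 o2] oq1] oq2] := (odd3 _ p1_mod4, odd3 _ p2_mod4, odd3 _ q1_mod4, odd3 _ q2_mod4).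
move: (distinct); rewrite /= !inE !negb_or.
case/and5P=> /and4P[n12 n13 n1q1 n1q2] /and3P[n23 n2q1 n2q2] /andP[n3q1 n3q2] nqq _.
have qp1 : legendre (q1 * q2)%N p1 = (-1) ^+ (nonres q1 p1 (+) nonres q2 p1).
  by apply: legendre_natM; rewrite ?dvdn_prime2.
have qp2 : legendre (q1 * q2)%N p2 = (-1) ^+ (nonres q1 p2 (+) nonres q2 p2).
  by apply: legendre_natM; rewrite ?dvdn_prime2.
have pq1 : legendre (p1 * p2)%N q1 = (-1) ^+ (nonres p1 q1 (+) nonres p2 q1).
  by apply: legendre_natM; rewrite ?dvdn_prime2 // eq_sym.
have pq2 : legendre (p1 * p2)%N q2 = (-1) ^+ (nonres p1 q2 (+) nonres p2 q2).
  by apply: legendre_natM; rewrite ?dvdn_prime2 // eq_sym.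
have res (x p : nat) : legendre x p = 1 -> nonres x p = false by move=> E; rewrite /nonres E.
have non (x p : nat) : legendre x p = -1 -> nonres x p = true by move=> E; rewrite /nonres E.
have sg1 (x : bool) : (-1) ^+ x = 1 :> int -> x = false by case: x.
have sgN (x : bool) : (-1) ^+ x = -1 :> int -> x = true by case: x.
rewrite qp1 qp2 pq1 pq2 /nonres_case in case_polya *.
split=> [[/res c12 /res c13 /non c23] [/non d1 /non d2 /non d3 /non d4] /sgN e|].
  by apply: case_polya; rewrite c12 c13 c23 d1 d2 d3 d4 e.
split=> [[/res c12 /non c13 /res c23] [/non d1 /non d2 /oppr_inj/res d3 /oppr_inj/res d4] /sgN e|].
  by apply: case_polya; rewrite c12 c13 c23 d1 d2 d3 d4 e !orbT.
split=> [[/non c13 /non c23] [/res d1 /(canRL (@opprK _))/non d2] [/sgN e1 /sgN e2 /oppr_inj/sg1 e3]|].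
  by apply: case_polya; rewrite c13 c23 d1 d2 e1 e2 e3 !orbT.
split=> [[/non c12 /res c13 /non c23] [/non d1 /non d2] [/sg1 e1 /sg1 e2 /(canRL (@opprK _))/sgN e3]|].
  by apply: case_polya; rewrite c12 c13 c23 d1 d2 e1 e2 e3 !orbT.
split=> // [[/non c12 /non c13 /res c23] [/non d1 /non d2 /non d3 /non d4] /sgN e].
by apply: case_polya; rewrite c12 c13 c23 d1 d2 d3 d4 e !orbT.
Qed.
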